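(* Let $(\lambda_n)_{n\ge1}$ be a sequence in $\mathbb C\setminus\{0\}$, let $\underline a=(a_n)$, $\underline b=(b_n)$ be sequences with $0<a_n<b_n$, and $\Delta_n=\log(b_n/a_n)$. Let $q\in(0,1)$, $\Delta>0$. There is a constant $a_0>0$ depending only on $\Delta,q$ such that, assuming: (a) for all sufficiently large $n$, $a_{n+1}\le|\lambda_{n+1}|e^{qa_n}$ and $b_{n+1}\ge|\lambda_{n+1}|e^{-qa_n}$; (b) $(a_1\cdots a_n)^{1/n}\to\infty$; (c) $\Delta_n>\Delta$ for all $n$; (d) $\liminf_{n\to\infty}a_n>a_0$; the following holds: if $\inf_{n\in\mathbb N}(\log^+ b_n)^{1/n}<\infty$, then $\dim_H I_{\underline a}^{\underline b}(E_{\underline\lambda})=1$. In particular, $\dim_H I_{\underline a}^{\underline b}(E_{\underline\lambda})=1$ if (a)–(d) hold and $I_{\underline a}^{\underline b}(E_{\underline\lambda})\subset M(E_{\underline\lambda})$.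
   Context: For $\lambda\in\mathbb C\setminus\{0\}$ let $E_\lambda(z)=\lambda e^z$. For $\underline\lambda=(\lambda_n)_{n\ge1}$ and sequences $\underline a,\underline b$ with $0<a_n<b_n$, \[ I_{\underline a}^{\underline b}(E_{\underline\lambda})=\{z\in\mathbb C:\ a_n\le |E_{\lambda_n}\circ\cdots\circ E_{\lambda_1}(z)|\le b_n \text{ for every sufficiently large } n\in\mathbb N\}. \] The escaping set is $I(E_{\underline\lambda})=\{z: |E_{\lambda_n}\circ\cdots\circ E_{\lambda_1}(z)|\to\infty\}$, and the moderately slow escaping set is \[ M(E_{\underline\lambda})=\Big\{z\in I(E_{\underline\lambda}):\ \limsup_{n\to\infty}\frac1n\log\log|E_{\lambda_n}\circ\cdots\circ E_{\lambda_1}(z)|<\infty\Big\}. \] $\log^+=\max(\log,0)$; $\dim_H$ is Hausdorff dimension.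
   Formalization: The condition inf_n (log^+ b_n)^{1/n} < ∞, which always holds literally and makes the claim false (for very fast growing b_n the dimension can be 2), is replaced by liminf_{n→∞} (log^+ b_n)^{1/n} < ∞. *)

(* Defs.v *)
From Stdlib Require Import Reals Lra.
From Coquelicot Require Import Coquelicot.
Open Scope R_scope.

(* Real power r^s for r > 0 (Rpower), with the convention r^s = 0 for r <= 0
   (only used for s > 0, where 0^s = 0). *)
Definition rpow (r s : R) : R := if Rle_dec r 0 then 0 else Rpower r s.

Definition logp (x : R) : R := Rmax (ln x) 0.

Definition Cexp (z : C) : C := (exp (fst z) * cos (snd z), exp (fst z) * sin (snd z)).

Definition E (lam z : C) : C := Cmult lam (Cexp z).

(* Sequences are indexed from 1; the value at index 0 is irrelevant.
   Eiter lam n z = E_{lam n} o ... o E_{lam 1} (z); Eiter lam 0 z = z. *)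
Fixpoint Eiter (lam : nat -> C) (n : nat) (z : C) : C :=
  match n with
  | O => z
  | S m => E (lam (S m)) (Eiter lam m z)
  end.

Definition Iab (lam : nat -> C) (a b : nat -> R) (z : C) : Prop :=
  exists N : nat, forall n : nat, (N <= n)%nat ->
    a n <= Cmod (Eiter lam n z) <= b n.

Definition Iesc (lam : nat -> C) (z : C) : Prop :=
  is_lim_seq (fun n => Cmod (Eiter lam n z)) p_infty.

Definition Mslow (lam : nat -> C) (z : C) : Prop :=
  Iesc lam z /\
  Rbar_lt (LimSup_seq (fun n => ln (ln (Cmod (Eiter lam n z))) / INR n)) p_infty.

Fixpoint prod1 (a : nat -> R) (n : nat) : R :=
  match n with
  | O => 1
  | S m => prod1 a m * a (S m)
  end.

Definition delta_cover (delta : R) (A : C -> Prop)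
    (U : nat -> C -> Prop) (r : nat -> R) : Prop :=
  (forall i, 0 <= r i <= delta) /\
  (forall i z w, U i z -> U i w -> Cmod (Cminus z w) <= r i) /\
  (forall z, A z -> exists i, U i z).

Definition cover_sum (s : R) (r : nat -> R) : Rbar :=
  Sup_seq (fun n => Finite (sum_n (fun i => rpow (r i) s) n)).

(* H^s_delta(A) = inf over delta-covers of sum diam^s  (inf of the empty set = +oo) *)
Definition Hdelta (s delta : R) (A : C -> Prop) : Rbar :=
  Glb_Rbar (fun x : R => exists U r, delta_cover delta A U r /\ cover_sum s r = Finite x).

(* H^s(A) = sup_{delta > 0} H^s_delta(A) = lim_{delta -> 0} (monotone) *)
Definition Hmeas (s : R) (A : C -> Prop) : Rbar :=
  Sup_seq (fun n => Hdelta s (/ (INR n + 1)) A).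

Definition dimH (A : C -> Prop) : Rbar :=
  Glb_Rbar (fun s : R => 0 < s /\ Hmeas s A = Finite 0).

(* Main.v *)
Require Import Defs.
From Stdlib Require Import Reals ZArith Lra Lia List IndefiniteDescription Classical.
From Coquelicot Require Import Coquelicot.
Open Scope R_scope.

(** Upper bound: a point with long orbit is determined up to C^n prod 1/|z_j| by the integer
    parts of Im z_j for j < n and of log |z_n|. Summing the s-th powers over the strips, each
    level contributes a factor at most C a_j^(1-s), while the n-th annulus needs about log b_n
    pieces. Since (a_1 ... a_n)^(1/n) tends to infinity, the total tends to 0 for every s > 1
    along times n at which log |z_n| <= B^n.

    Lower bound: by (a), the n-th annulus meets the preimage of the (n+1)-st one in a vertical
    strip of width D = min(Delta, 1) over a height comparable to a_n. It therefore contains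
    N_n >= c a_n boxes, spaced by 4 pi, each of which E_(lambda_(n+1)) maps over all the boxes
    of the next level. Every itinerary is realised; coding the itineraries by the mixed radix
    expansion with bases N_n, the digits of x in [0,1) depend on the point in a Hoelder way for
    each exponent s < 1, because the constants c^n are absorbed by the growth of the product of
    the radii. A cover of the set by sets with small sum of diam^s would then give a cover of
    [0,1) by intervals of small total length. *)

(** * Metric estimates for the exponential map *)

(** The upper bound runs backwards. A cover of the n-th image is pulled back level by level, each
    piece splitting into one piece per horizontal strip of height 1. A piece of relative size r at
    level j+1 has absolute diameter at most 3r at level j; dividing by the modulus in the i-th strip
    gives sizes of order r / (a_j + i), and the sum of their s-th powers over i is of order
    a_j^(1-s) because s > 1. The factors picked up before the orbit enters the annuli depend on the
    point, which is why the set is first cut into countably many parts with uniform bounds.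

    The lower bound uses no measure on the set: a Hoelder estimate for the inverse coding reduces it
    to the fact that intervals of small total length do not cover [0,1/2].

    The threshold a_0 has two sources, both in [level_boxes]: 512 / D makes room for enough boxes,
    and 3 D / (2 (1 - q)) keeps the strip so far inside the circle that crossing it changes x^2 by
    at most 2 D rho. *)

Lemma Cmod_sqr (z : C) : Cmod z ^ 2 = fst z ^ 2 + snd z ^ 2.
Proof.
  unfold Cmod. rewrite pow2_sqrt; [reflexivity|].
  generalize (pow2_ge_0 (fst z)) (pow2_ge_0 (snd z)); lra.
Qed.

Lemma Cmod_le_sqr (z : C) (r : R) : 0 <= r -> fst z ^ 2 + snd z ^ 2 <= r ^ 2 -> Cmod z <= r.
Proof.
  intros Hr H. rewrite <- Cmod_sqr in H. generalize (Cmod_ge_0 z). nra.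
Qed.

Lemma Cmod_ge_sqr (z : C) (r : R) : 0 <= r -> r ^ 2 <= fst z ^ 2 + snd z ^ 2 -> r <= Cmod z.
Proof.
  intros Hr H. rewrite <- Cmod_sqr in H. generalize (Cmod_ge_0 z). nra.
Qed.

Lemma Rabs_Im_le_Cmod (z : C) : Rabs (snd z) <= Cmod z.
Proof.
  apply Cmod_ge_sqr; [apply Rabs_pos|]. rewrite pow2_abs.
  generalize (pow2_ge_0 (fst z)); lra.
Qed.

Lemma Rabs_Re_le_Cmod (z : C) : Rabs (fst z) <= Cmod z.
Proof.
  apply Cmod_ge_sqr; [apply Rabs_pos|]. rewrite pow2_abs.
  generalize (pow2_ge_0 (snd z)); lra.
Qed.

Lemma Cmod_le_Rabs (z : C) : Cmod z <= Rabs (fst z) + Rabs (snd z).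
Proof.
  generalize (Rabs_pos (fst z)) (Rabs_pos (snd z)); intros H1 H2.
  apply Cmod_le_sqr; [lra|].
  rewrite <- (pow2_abs (fst z)), <- (pow2_abs (snd z)). nra.
Qed.

Lemma Cmod_Cexp (z : C) : Cmod (Cexp z) = exp (fst z).
Proof.
  generalize (exp_pos (fst z)); intros He.
  assert (H : fst (Cexp z) ^ 2 + snd (Cexp z) ^ 2 = exp (fst z) ^ 2).
  { unfold Cexp; simpl fst; simpl snd.
    generalize (sin2_cos2 (snd z)); unfold Rsqr; intros Hs.
    replace ((exp (fst z) * cos (snd z)) ^ 2 + (exp (fst z) * sin (snd z)) ^ 2)
      with (exp (fst z) ^ 2 * (sin (snd z) * sin (snd z) + cos (snd z) * cos (snd z))) by ring.
    rewrite Hs; ring. }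
  apply Rle_antisym; [apply Cmod_le_sqr | apply Cmod_ge_sqr]; lra.
Qed.

Lemma Cmod_E (lam z : C) : Cmod (E lam z) = Cmod lam * exp (fst z).
Proof. unfold E. now rewrite Cmod_mult, Cmod_Cexp. Qed.

(** Law of cosines. It separates the radial from the angular part, so the Lipschitz and the
    expansion bound both reduce to one-variable inequalities for [exp] and [sin]. *)
Lemma Cmod_Cexp_minus_sqr (z w : C) :
  Cmod (Cminus (Cexp z) (Cexp w)) ^ 2 =
  (exp (fst z) - exp (fst w)) ^ 2
  + exp (fst z) * exp (fst w) * (2 * (1 - cos (snd z - snd w))).
Proof.
  rewrite Cmod_sqr. unfold Cminus, Cplus, Copp, Cexp; simpl fst; simpl snd.
  rewrite cos_minus.
  generalize (sin2_cos2 (snd z)) (sin2_cos2 (snd w)); unfold Rsqr.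
  set (a := exp (fst z)); set (b := exp (fst w)).
  set (c := cos (snd z)); set (s := sin (snd z)).
  set (c' := cos (snd w)); set (s' := sin (snd w)). intros H1 H2.
  replace ((a * c + - (b * c')) ^ 2 + (a * s + - (b * s')) ^ 2)
    with (a ^ 2 * (s * s + c * c) + b ^ 2 * (s' * s' + c' * c')
          - 2 * a * b * (c * c' + s * s')) by ring.
  rewrite H1, H2. ring.
Qed.

Lemma one_minus_cos (t : R) : 2 * (1 - cos t) = 4 * sin (t / 2) ^ 2.
Proof.
  replace t with (2 * (t / 2)) at 1 by field. rewrite cos_2a_sin. ring.
Qed.

Lemma sin_sqr_le (x : R) : sin x ^ 2 <= x ^ 2.
Proof.
  assert (K : forall y, 0 <= y -> sin y ^ 2 <= y ^ 2).
  { intros y Hy. destruct (Rle_lt_dec y 1) as [H1|H1].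
    - destruct (Req_dec y 0) as [->|Hn]; [rewrite sin_0; lra|].
      assert (sin y < y) by (apply sin_lt_x; lra).
      assert (0 <= sin y) by (apply sin_ge_0; generalize PI2_1; lra). nra.
    - generalize (SIN_bound y); intros. nra. }
  destruct (Rle_lt_dec 0 x) as [H|H]; [now apply K|].
  specialize (K (- x)). rewrite sin_neg in K.
  replace (x ^ 2) with ((- x) ^ 2) by ring. replace (sin x ^ 2) with ((- sin x) ^ 2) by ring.
  apply K; lra.
Qed.

(** On [0,2] the factor in x (1 - x^2 / 6) <= sin x is at least 1/3. This 1/3 is the origin of the
    constant 3 in [E_expanding]. *)
Lemma sin_ge_third (x : R) : 0 <= x <= 2 -> x / 3 <= sin x.
Proof.
  intros [H0 H2].
  destruct (pre_sin_bound x 0) as [H _]; [lra|lra|].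
  replace (sin_approx x (2 * 0 + 1)) with (x - x ^ 3 / 6) in H.
  - nra.
  - unfold sin_approx, sin_term; simpl. field.
Qed.

Lemma sin_sqr_ge (x : R) : Rabs x <= PI / 2 -> x ^ 2 / 9 <= sin x ^ 2.
Proof.
  intros H. generalize PI_4; intros HP.
  assert (K : Rabs x / 3 <= sin (Rabs x)) by (apply sin_ge_third; generalize (Rabs_pos x); lra).
  replace (sin x ^ 2) with (sin (Rabs x) ^ 2).
  - rewrite <- (pow2_abs x). generalize (Rabs_pos x); nra.
  - unfold Rabs; destruct (Rcase_abs x); [rewrite sin_neg; ring|reflexivity].
Qed.

Lemma exp_minus_le (x y : R) : x <= y -> exp y - exp x <= exp y * (y - x).
Proof.
  intros H. generalize (exp_ineq1_le (x - y)); intros H1.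
  replace (exp x) with (exp y * exp (x - y)) by (rewrite <- exp_plus; f_equal; ring).
  generalize (exp_pos y); nra.
Qed.

Lemma exp_minus_ge (x y : R) : x <= y -> exp x * (y - x) <= exp y - exp x.
Proof.
  intros H. generalize (exp_ineq1_le (y - x)); intros H1.
  replace (exp y) with (exp x * exp (y - x)) by (rewrite <- exp_plus; f_equal; ring).
  generalize (exp_pos x); nra.
Qed.

Lemma Cmod_Cminus_sym (z w : C) : Cmod (Cminus z w) = Cmod (Cminus w z).
Proof. rewrite <- Cmod_opp. f_equal. ring. Qed.

Lemma Cexp_lipschitz (z w : C) (M : R) :
  exp (fst z) <= M -> exp (fst w) <= M ->
  Cmod (Cminus (Cexp z) (Cexp w)) <= M * Cmod (Cminus z w).
Proof.
  assert (K : forall z w : C, fst z <= fst w ->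
    Cmod (Cminus (Cexp z) (Cexp w)) <= exp (fst w) * Cmod (Cminus z w)).
  { clear z w M. intros z w H.
    generalize (Cmod_Cexp_minus_sqr z w); rewrite one_minus_cos; intros Hs.
    generalize (Cmod_sqr (Cminus z w)).
    change (fst (Cminus z w)) with (fst z - fst w).
    change (snd (Cminus z w)) with (snd z - snd w). intros Hd.
    generalize (sin_sqr_le ((snd z - snd w) / 2)); intros Hsin.
    generalize (Cmod_ge_0 (Cminus (Cexp z) (Cexp w))) (Cmod_ge_0 (Cminus z w)).
    generalize (exp_pos (fst w)) (exp_pos (fst z)) (exp_minus_le _ _ H); intros.
    assert (exp (fst z) <= exp (fst w)) by (destruct H as [H|H]; [left; now apply exp_increasing|rewrite H; lra]).
    assert (Hre : (exp (fst z) - exp (fst w)) ^ 2 <= exp (fst w) ^ 2 * (fst z - fst w) ^ 2) by nra.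
    assert (Him : exp (fst z) * exp (fst w) * (4 * sin ((snd z - snd w) / 2) ^ 2)
                 <= exp (fst w) ^ 2 * (snd z - snd w) ^ 2).
    { assert (4 * sin ((snd z - snd w) / 2) ^ 2 <= (snd z - snd w) ^ 2) by lra.
      assert (0 <= 4 * sin ((snd z - snd w) / 2) ^ 2) by (generalize (pow2_ge_0 (sin ((snd z - snd w) / 2))); lra).
      replace (exp (fst w) ^ 2) with (exp (fst w) * exp (fst w)) by ring.
      apply Rmult_le_compat; [nra|lra|nra|lra]. }
    apply Rsqr_incr_0_var; [unfold Rsqr|nra].
    replace (Cmod (Cminus (Cexp z) (Cexp w)) * Cmod (Cminus (Cexp z) (Cexp w)))
      with (Cmod (Cminus (Cexp z) (Cexp w)) ^ 2) by ring.
    replace (exp (fst w) * Cmod (Cminus z w) * (exp (fst w) * Cmod (Cminus z w)))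
      with (exp (fst w) ^ 2 * Cmod (Cminus z w) ^ 2) by ring.
    rewrite Hs, Hd. lra. }
  intros H1 H2. generalize (Cmod_ge_0 (Cminus z w)); intros H0.
  destruct (Rle_lt_dec (fst z) (fst w)) as [H|H].
  - eapply Rle_trans; [now apply K|]. now apply Rmult_le_compat_r.
  - rewrite Cmod_Cminus_sym. eapply Rle_trans; [apply K; lra|].
    rewrite (Cmod_Cminus_sym w z). now apply Rmult_le_compat_r.
Qed.

Lemma Cexp_expanding (z w : C) (m : R) :
  0 <= m -> m <= exp (fst z) -> m <= exp (fst w) -> Rabs (snd z - snd w) <= PI ->
  m * Cmod (Cminus z w) <= 3 * Cmod (Cminus (Cexp z) (Cexp w)).
Proof.
  assert (K : forall z w : C, fst z <= fst w -> Rabs (snd z - snd w) <= PI ->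
    exp (fst z) * Cmod (Cminus z w) <= 3 * Cmod (Cminus (Cexp z) (Cexp w))).
  { clear z w m. intros z w H HP.
    generalize (Cmod_Cexp_minus_sqr z w); rewrite one_minus_cos; intros Hs.
    generalize (Cmod_sqr (Cminus z w)).
    change (fst (Cminus z w)) with (fst z - fst w).
    change (snd (Cminus z w)) with (snd z - snd w). intros Hd.
    assert (Hsin : (snd z - snd w) ^ 2 / 36 <= sin ((snd z - snd w) / 2) ^ 2).
    { replace ((snd z - snd w) ^ 2 / 36) with (((snd z - snd w) / 2) ^ 2 / 9) by field.
      apply sin_sqr_ge. unfold Rdiv at 1. rewrite Rabs_mult, (Rabs_right (/ 2)); lra. }
    generalize (Cmod_ge_0 (Cminus (Cexp z) (Cexp w))) (Cmod_ge_0 (Cminus z w)).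
    generalize (exp_pos (fst w)) (exp_pos (fst z)) (exp_minus_ge _ _ H); intros.
    assert (exp (fst z) <= exp (fst w)) by (destruct H as [H|H]; [left; now apply exp_increasing|rewrite H; lra]).
    assert (Hre : exp (fst z) ^ 2 * (fst z - fst w) ^ 2 <= (exp (fst z) - exp (fst w)) ^ 2).
    { replace (exp (fst z) ^ 2 * (fst z - fst w) ^ 2) with ((exp (fst z) * (fst w - fst z)) ^ 2) by ring.
      replace ((exp (fst z) - exp (fst w)) ^ 2) with ((exp (fst w) - exp (fst z)) ^ 2) by ring.
      apply pow_incr. split; [|lra]. apply Rmult_le_pos; lra. }
    assert (Him : exp (fst z) ^ 2 * ((snd z - snd w) ^ 2 / 9)
                 <= exp (fst z) * exp (fst w) * (4 * sin ((snd z - snd w) / 2) ^ 2)).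
    { replace (exp (fst z) ^ 2) with (exp (fst z) * exp (fst z)) by ring.
      generalize (pow2_ge_0 (snd z - snd w)); intros.
      apply Rmult_le_compat; [nra|lra|nra|lra]. }
    apply Rsqr_incr_0_var; [unfold Rsqr|nra].
    replace (3 * Cmod (Cminus (Cexp z) (Cexp w)) * (3 * Cmod (Cminus (Cexp z) (Cexp w))))
      with (9 * Cmod (Cminus (Cexp z) (Cexp w)) ^ 2) by ring.
    replace (exp (fst z) * Cmod (Cminus z w) * (exp (fst z) * Cmod (Cminus z w)))
      with (exp (fst z) ^ 2 * Cmod (Cminus z w) ^ 2) by ring.
    rewrite Hs, Hd.
    assert (0 <= exp (fst z) ^ 2 * (fst z - fst w) ^ 2) by (apply Rmult_le_pos; apply pow2_ge_0).
    lra. }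
  intros Hm H1 H2 HP. generalize (Cmod_ge_0 (Cminus z w)); intros H0.
  destruct (Rle_lt_dec (fst z) (fst w)) as [H|H].
  - eapply Rle_trans; [|now apply K]. now apply Rmult_le_compat_r.
  - rewrite (Cmod_Cminus_sym (Cexp z)). eapply Rle_trans; [|apply K; [lra|now rewrite Rabs_minus_sym]].
    rewrite (Cmod_Cminus_sym w z). now apply Rmult_le_compat_r.
Qed.

Lemma E_minus (lam z w : C) :
  Cmod (Cminus (E lam z) (E lam w)) = Cmod lam * Cmod (Cminus (Cexp z) (Cexp w)).
Proof. rewrite <- Cmod_mult. f_equal. unfold E. ring. Qed.

Lemma E_lipschitz (lam z w : C) (M : R) :
  Cmod (E lam z) <= M -> Cmod (E lam w) <= M ->
  Cmod (Cminus (E lam z) (E lam w)) <= M * Cmod (Cminus z w).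
Proof.
  destruct (Req_dec (Cmod lam) 0) as [H0|H0].
  { rewrite E_minus, Cmod_E, H0, !Rmult_0_l. intros H _.
    apply Rmult_le_pos; [lra|apply Cmod_ge_0]. }
  assert (Hl : 0 < Cmod lam) by (generalize (Cmod_ge_0 lam); lra).
  rewrite E_minus, !Cmod_E. intros H1 H2.
  replace (M * Cmod (Cminus z w)) with (Cmod lam * (M / Cmod lam * Cmod (Cminus z w))) by (field; lra).
  apply Rmult_le_compat_l; [lra|].
  apply Cexp_lipschitz; apply Rmult_le_reg_l with (Cmod lam); try lra;
    field_simplify (Cmod lam * (M / Cmod lam)); lra.
Qed.

(* Explicit expansion in place of Koebe distortion: constants to the power n are
   harmless because (a_1 ... a_n)^(1/n) tends to infinity. *)
Lemma E_expanding (lam z w : C) (m : R) :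
  0 <= m -> m <= Cmod (E lam z) -> m <= Cmod (E lam w) -> Rabs (snd z - snd w) <= PI ->
  m * Cmod (Cminus z w) <= 3 * Cmod (Cminus (E lam z) (E lam w)).
Proof.
  destruct (Req_dec (Cmod lam) 0) as [H0|H0].
  { rewrite E_minus, Cmod_E, H0, !Rmult_0_l. intros Hm H _ _.
    replace m with 0 by lra. lra. }
  assert (Hl : 0 < Cmod lam) by (generalize (Cmod_ge_0 lam); lra).
  rewrite E_minus, !Cmod_E. intros Hm H1 H2 HP.
  replace (m * Cmod (Cminus z w)) with (Cmod lam * (m / Cmod lam * Cmod (Cminus z w))) by (field; lra).
  replace (3 * (Cmod lam * Cmod (Cminus (Cexp z) (Cexp w))))
    with (Cmod lam * (3 * Cmod (Cminus (Cexp z) (Cexp w)))) by ring.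
  apply Rmult_le_compat_l; [lra|].
  apply Cexp_expanding; trivial.
  - apply Rmult_le_pos; [lra|]. left; now apply Rinv_0_lt_compat.
  - apply Rmult_le_reg_l with (Cmod lam); trivial. field_simplify (Cmod lam * (m / Cmod lam)); lra.
  - apply Rmult_le_reg_l with (Cmod lam); trivial. field_simplify (Cmod lam * (m / Cmod lam)); lra.
Qed.

(** * Covers and Hausdorff measure *)

Lemma rpow_pos_eq (x s : R) : 0 < x -> rpow x s = Rpower x s.
Proof. intros H. unfold rpow. destruct (Rle_dec x 0); [lra|reflexivity]. Qed.

Lemma rpow_nonpos (x s : R) : x <= 0 -> rpow x s = 0.
Proof. intros H. unfold rpow. destruct (Rle_dec x 0); [reflexivity|lra]. Qed.

Lemma rpow_ge_0 (x s : R) : 0 <= rpow x s.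
Proof. unfold rpow. destruct (Rle_dec x 0); [lra|]. left; apply exp_pos. Qed.

Lemma Rpower_pos (x s : R) : 0 < Rpower x s.
Proof. apply exp_pos. Qed.

Lemma rpow_scale (c x s : R) : 0 < c -> rpow (c * x) s = Rpower c s * rpow x s.
Proof.
  intros Hc. destruct (Rle_lt_dec x 0) as [H|H].
  - rewrite !rpow_nonpos; [ring|lra|nra].
  - rewrite !rpow_pos_eq; [symmetry; now apply Rpower_mult_distr|lra|nra].
Qed.

Lemma rpow_le_inv (x y s : R) : 0 < s -> 0 < y -> rpow x s <= rpow y s -> x <= y.
Proof.
  intros Hs Hy H. destruct (Rle_lt_dec x y) as [|Hxy]; [trivial|].
  rewrite !rpow_pos_eq in H by lra.
  assert (Rpower y s < Rpower x s) by (apply Rlt_Rpower_l; lra). lra.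
Qed.

Definition weight (s : R) (l : list ((C -> Prop) * R)) : R :=
  fold_right (fun p t => rpow (snd p) s + t) 0 l.

(* Taking [g = Cmod] makes the size of a piece a ratio diam/|z|, the quantity that
   transforms well under inverse branches of the exponential; [g = 1] gives diameters. *)
Definition scaled_cover (g : C -> R) (s : R) (T : C -> Prop) (tau : R) : Prop :=
  exists l : list ((C -> Prop) * R),
    (forall p, In p l -> 0 <= snd p /\
       forall z w, fst p z -> fst p w -> Cmod (Cminus z w) <= snd p * g z) /\
    (forall z, T z -> exists p, In p l /\ fst p z) /\
    weight s l <= tau.

Lemma weight_ge_0 s l : 0 <= weight s l.
Proof.
  induction l as [|p l IH]; simpl; [lra|]. generalize (rpow_ge_0 (snd p) s); lra.
Qed.

Lemma weight_app s l l' : weight s (l ++ l') = weight s l + weight s l'.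
Proof. induction l as [|p l IH]; simpl; [ring|]. rewrite IH; ring. Qed.

Lemma scaled_cover_weaken g s (T T' : C -> Prop) tau tau' :
  (forall z, T' z -> T z) -> tau <= tau' -> scaled_cover g s T tau -> scaled_cover g s T' tau'.
Proof.
  intros HT Ht (l & H1 & H2 & H3). exists l. repeat split; try apply H1; trivial; [|lra].
  intros z Hz; apply H2, HT, Hz.
Qed.

(** The factor by which the weight of a cover grows under one pullback: 3 is the expansion constant,
    divided by the lower bound for the normalising function. *)
Definition strip_sum (s : R) (ks : list (R * R)) : R :=
  fold_right (fun k t => Rpower (3 / snd k) s + t) 0 ks.

Lemma strip_sum_app s l l' : strip_sum s (l ++ l') = strip_sum s l + strip_sum s l'.
Proof. induction l as [|p l IH]; simpl; [ring|]. rewrite IH; ring. Qed.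

Lemma strip_sum_ge_0 s l : 0 <= strip_sum s l.
Proof. induction l as [|p l IH]; simpl; [lra|]. generalize (Rpower_pos (3 / snd p) s); lra. Qed.

(* The pairs in [ks] are (lower end of a horizontal strip of height 1, lower bound for g there). *)
Lemma scaled_cover_pullback (g : C -> R) (s : R) (lam : C) (T T' : C -> Prop)
    (ks : list (R * R)) (tau : R) :
  lam <> 0%C ->
  (forall k, In k ks -> 0 < snd k) ->
  (forall w, T w -> T' (E lam w) /\
     exists k, In k ks /\ fst k <= snd w <= fst k + 1 /\ snd k <= g w) ->
  scaled_cover Cmod s T' tau -> scaled_cover g s T (strip_sum s ks * tau).
Proof.
  intros Hlam Hks HT (l & H1 & H2 & H3).
  set (P := fun (p : (C -> Prop) * R) (k : R * R) =>
    ((fun w : C => fst k <= snd w <= fst k + 1 /\ snd k <= g w /\ fst p (E lam w)),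
     3 / snd k * snd p)).
  exists (flat_map (fun p => map (P p) ks) l). split; [|split].
  - intros p' Hp'. apply in_flat_map in Hp'. destruct Hp' as (p & Hp & Hk).
    apply in_map_iff in Hk. destruct Hk as (k & <- & Hk).
    destruct (H1 p Hp) as [Hp0 Hp1]. specialize (Hks k Hk).
    assert (H3k : 0 < 3 / snd k) by (apply Rdiv_lt_0_compat; lra).
    split; [simpl; apply Rmult_le_pos; lra|].
    unfold P; simpl. intros z w (Hz1 & Hz2 & Hz3) (Hw1 & Hw2 & Hw3).
    assert (Hl : 0 < Cmod lam) by now apply Cmod_gt_0.
    assert (HEz : 0 < Cmod (E lam z)) by (rewrite Cmod_E; apply Rmult_lt_0_compat; [trivial|apply exp_pos]).
    assert (HEw : 0 < Cmod (E lam w)) by (rewrite Cmod_E; apply Rmult_lt_0_compat; [trivial|apply exp_pos]).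
    (* Expansion holds with the smaller of the two image moduli, and the size condition of a piece
       may be read at either of its points. *)
    set (m := Rmin (Cmod (E lam z)) (Cmod (E lam w))).
    assert (Hm : 0 < m) by (now apply Rmin_pos).
    assert (Hexp : m * Cmod (Cminus z w) <= 3 * Cmod (Cminus (E lam z) (E lam w))).
    { apply E_expanding; [lra|apply Rmin_l|apply Rmin_r|].
      apply Rabs_le. generalize PI2_1; lra. }
    assert (HE : Cmod (Cminus (E lam z) (E lam w)) <= snd p * m).
    { unfold m. apply Rmin_case; [now apply Hp1|]. rewrite Cmod_Cminus_sym. now apply Hp1. }
    assert (H4 : Cmod (Cminus z w) <= 3 * snd p).
    { apply Rmult_le_reg_l with m; trivial. lra. }
    apply Rle_trans with (1 := H4).
    replace (3 * snd p) with (3 / snd k * snd p * snd k) by (field; lra).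
    apply Rmult_le_compat_l; trivial. apply Rmult_le_pos; lra.
  - intros z Hz. destruct (HT z Hz) as (Hz' & k & Hk & Hk1 & Hk2).
    destruct (H2 _ Hz') as (p & Hp & Hpz).
    exists (P p k). split; [|now unfold P; simpl].
    apply in_flat_map. exists p. split; trivial. now apply in_map.
  - assert (Hw : weight s (flat_map (fun p => map (P p) ks) l) = strip_sum s ks * weight s l).
    { clear H1 H2 H3. induction l as [|p l IH]; simpl; [ring|].
      rewrite weight_app, IH, Rmult_plus_distr_l. f_equal. clear IH HT.
      induction ks as [|k ks IH]; simpl; [ring|].
      rewrite IH by (intros; apply Hks; now right).
      rewrite rpow_scale; [ring|]. apply Rdiv_lt_0_compat; [lra|]. apply Hks; now left. }
    rewrite Hw. apply Rmult_le_compat_l; trivial. apply strip_sum_ge_0.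
Qed.

(** * Horizontal strips and the sums over them *)

Definition strips (d : nat -> R) (K : nat) : list (R * R) :=
  flat_map (fun i => (INR i, d i) :: (- INR i - 1, d i) :: nil) (seq 0 K).

Lemma strips_cover (d : nat -> R) (K : nat) (w : C) :
  Cmod w < INR K ->
  exists k i, In k (strips d K) /\ fst k <= snd w <= fst k + 1 /\ snd k = d i /\ INR i <= Cmod w.
Proof.
  intros HK. generalize (Rabs_Im_le_Cmod w); intros Hw.
  destruct (nfloor_ex (Rabs (snd w))) as (i & Hi); [apply Rabs_pos|].
  assert (HiK : (i < K)%nat) by (apply INR_lt; lra).
  assert (Hin : In i (seq 0 K)) by (apply in_seq; lia).
  unfold Rabs in *. destruct (Rcase_abs (snd w)).
  - exists (- INR i - 1, d i), i. split; [|simpl; repeat split; lra].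
    apply in_flat_map. exists i. split; simpl; auto.
  - exists (INR i, d i), i. split; [|simpl; repeat split; lra].
    apply in_flat_map. exists i. split; simpl; auto.
Qed.

Lemma strips_pos (d : nat -> R) (K : nat) k :
  (forall i, 0 < d i) -> In k (strips d K) -> 0 < snd k.
Proof.
  intros Hd H. apply in_flat_map in H. destruct H as (i & _ & [<-|[<-|[]]]); apply Hd.
Qed.

(** Comparison of the sum of x^(-s) with its integral; exp u >= 1 + u takes the place of the mean
    value theorem. *)
Lemma Rpower_telescope (x s : R) : 0 < x -> 1 < s ->
  (s - 1) * Rpower (x + 1) (- s) <= Rpower x (1 - s) - Rpower (x + 1) (1 - s).
Proof.
  intros Hx Hs. unfold Rpower.
  set (u := ln (x + 1)).
  replace (exp ((1 - s) * u)) with (exp (- s * u) * (x + 1))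
    by (rewrite <- (exp_ln (x + 1)) by lra; unfold u; rewrite <- exp_plus; f_equal; ring).
  replace (exp ((1 - s) * ln x)) with (exp (- s * u) * (x + 1) * exp ((s - 1) * (u - ln x)))
    by (rewrite <- (exp_ln (x + 1)) at 1 by lra; unfold u; rewrite <- !exp_plus; f_equal; ring).
  generalize (exp_pos (- s * u)); set (e := exp (- s * u)); intros He.
  assert (H1 : 1 / (x + 1) <= u - ln x).
  { generalize (exp_ineq1_le (ln x - u)). unfold u, Rminus. rewrite exp_plus, exp_Ropp, !exp_ln by lra.
    intros H. replace (1 / (x + 1)) with (1 - x * / (x + 1)) by (field; lra). lra. }
  generalize (exp_ineq1_le ((s - 1) * (u - ln x))); intros H2.
  assert (H3 : (s - 1) * (1 / (x + 1)) <= (s - 1) * (u - ln x)) by (apply Rmult_le_compat_l; lra).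
  assert (H4 : e * (x + 1) * (1 + (s - 1) * (1 / (x + 1))) <=
     e * (x + 1) * exp ((s - 1) * (u - ln x))) by (apply Rmult_le_compat_l; [nra|lra]).
  replace (e * (x + 1) * (1 + (s - 1) * (1 / (x + 1)))) with (e * (x + 1) + (s - 1) * e) in H4 by (field; lra).
  lra.
Qed.

(** The 2 counts strips above and below the real axis, 6^s comes from 3 / ((a + i) / 2), a further
    2^s from replacing a - 1 by a, and 1 / (s - 1) from the telescoping sum. *)
Definition strip_const (s : R) : R := 2 * Rpower 12 s / (s - 1).

Lemma strip_const_pos s : 1 < s -> 0 < strip_const s.
Proof. intros. unfold strip_const. generalize (Rpower_pos 12 s). intros. apply Rdiv_lt_0_compat; lra. Qed.

Lemma strips_sum_le (a s : R) (K : nat) : 2 <= a -> 1 < s ->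
  strip_sum s (strips (fun i => (a + INR i) / 2) K) <= strip_const s * Rpower a (1 - s).
Proof.
  intros Ha Hs.
  (* Keeping the subtracted tail lets the induction on K telescope, and the resulting bound does not
     depend on K. *)
  assert (H : strip_sum s (strips (fun i => (a + INR i) / 2) K) <=
    2 * Rpower 6 s / (s - 1) * (Rpower (a - 1) (1 - s) - Rpower (a - 1 + INR K) (1 - s))).
  { induction K as [|K IH].
    - simpl. rewrite Rplus_0_r. lra.
    - unfold strips. rewrite seq_S, flat_map_app, strip_sum_app. fold (strips (fun i => (a + INR i) / 2) K).
      generalize (pos_INR K); intros HK.
      generalize (Rpower_telescope (a - 1 + INR K) s); rewrite S_INR.
      replace (a - 1 + INR K + 1) with (a + INR K) by ring.
      replace (a - 1 + (INR K + 1)) with (a + INR K) by ring. intros Ht.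
      specialize (Ht ltac:(lra) Hs).
      simpl strip_sum.
      replace (Rpower (3 / ((a + INR K) / 2)) s) with (Rpower 6 s * Rpower (a + INR K) (- s)).
      2:{ replace (3 / ((a + INR K) / 2)) with (6 * / (a + INR K)) by (field; lra).
          rewrite <- Rpower_mult_distr; [|lra|apply Rinv_0_lt_compat; lra].
          f_equal. unfold Rpower. f_equal. rewrite ln_Rinv by lra. ring. }
      generalize (Rpower_pos 6 s); intros H6.
      apply Rle_trans with (1 := Rplus_le_compat_r _ _ _ IH).
      set (A := Rpower (a - 1) (1 - s)) in *. set (B := Rpower (a - 1 + INR K) (1 - s)) in *.
      set (D := Rpower (a + INR K) (1 - s)) in *. set (F := Rpower (a + INR K) (- s)) in *.
      assert (HF : F <= (B - D) / (s - 1)).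
      { apply Rmult_le_reg_l with (s - 1); [lra|]. replace ((s - 1) * ((B - D) / (s - 1))) with (B - D) by (field; lra). lra. }
      assert (2 * Rpower 6 s * F <= 2 * Rpower 6 s * ((B - D) / (s - 1))) by (apply Rmult_le_compat_l; lra).
      replace (2 * Rpower 6 s / (s - 1) * (A - D)) with
        (2 * Rpower 6 s / (s - 1) * (A - B) + 2 * Rpower 6 s * ((B - D) / (s - 1))) by (field; lra).
      lra. }
  apply Rle_trans with (1 := H).
  generalize (Rpower_pos (a - 1 + INR K) (1 - s)) (Rpower_pos 6 s); intros H1 H6.
  assert (Hc : 0 < 2 * Rpower 6 s / (s - 1)) by (apply Rdiv_lt_0_compat; lra).
  apply Rle_trans with (2 * Rpower 6 s / (s - 1) * Rpower (a - 1) (1 - s)).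
  { apply Rmult_le_compat_l; lra. }
  assert (H2 : Rpower (a - 1) (1 - s) <= Rpower 2 (s - 1) * Rpower a (1 - s)).
  { unfold Rpower. rewrite <- exp_plus.
    assert (ln a <= ln 2 + ln (a - 1)).
    { rewrite <- ln_mult by lra. apply ln_le; lra. }
    destruct (Rle_lt_dec ((1 - s) * ln (a - 1)) ((s - 1) * ln 2 + (1 - s) * ln a)) as [[h|h]|h].
    - left; now apply exp_increasing.
    - rewrite h; lra.
    - exfalso. nra. }
  assert (H3 : Rpower 2 (s - 1) <= Rpower 2 s) by (apply Rle_Rpower; lra).
  assert (H4 : Rpower 12 s = Rpower 6 s * Rpower 2 s) by (rewrite Rpower_mult_distr by lra; f_equal; ring).
  unfold strip_const. rewrite H4.
  replace (2 * (Rpower 6 s * Rpower 2 s) / (s - 1) * Rpower a (1 - s)) with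
   (2 * Rpower 6 s / (s - 1) * (Rpower 2 s * Rpower a (1 - s))) by (field; lra).
  apply Rmult_le_compat_l; [lra|]. apply Rle_trans with (1 := H2).
  apply Rmult_le_compat_r; [left; apply Rpower_pos|lra].
Qed.

(** On the ring e^m <= |z| <= e^(m+1) the diameter is at most (1 + e) |z| <= 4 |z|, so one piece per
    unit of log |z| has bounded relative size. *)
Lemma annulus_cover (s : R) (M : nat) :
  scaled_cover Cmod s (fun z => 1 <= Cmod z < exp (INR M)) (INR M * Rpower 4 s).
Proof.
  exists (map (fun m => ((fun z : C => exp (INR m) <= Cmod z <= exp (INR (S m))), 4)) (seq 0 M)).
  split; [|split].
  - intros p Hp. apply in_map_iff in Hp. destruct Hp as (m & <- & Hm). cbn [fst snd].
    split; [lra|]. intros z w Hz Hw. rewrite S_INR, exp_plus in Hw.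
    generalize exp_le_3 (exp_pos (INR m)); intros.
    apply Rle_trans with (Cmod z + Cmod w).
    { unfold Cminus. rewrite <- (Cmod_opp w). apply Cmod_triangle. }
    nra.
  - intros z [H1 H2]. assert (H0 : 0 < Cmod z) by lra.
    destruct (nfloor_ex (ln (Cmod z))) as (m & Hm1 & Hm2).
    { rewrite <- ln_1. apply ln_le; lra. }
    exists ((fun z : C => exp (INR m) <= Cmod z <= exp (INR (S m))), 4). split.
    + apply in_map_iff. exists m. split; trivial. apply in_seq. split; [lia|].
      apply INR_lt. simpl. apply Rle_lt_trans with (1 := Hm1). rewrite <- (ln_exp (INR M)). now apply ln_increasing.
    + cbn [fst]. rewrite S_INR. rewrite <- (exp_ln (Cmod z)) by trivial. split.
      * destruct Hm1 as [h|h]; [left; now apply exp_increasing|rewrite h; lra].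
      * left; now apply exp_increasing.
  - assert (H : forall i, weight s (map (fun m => ((fun z : C => exp (INR m) <= Cmod z <= exp (INR (S m))), 4)) (seq i M)) = INR M * Rpower 4 s).
    { induction M as [|M IH]; intros i; [simpl; ring|].
      simpl seq. simpl map. cbn [weight fold_right snd].
      change (fold_right _ 0 ?l) with (weight s l). rewrite IH, S_INR, rpow_pos_eq by lra. ring. }
    rewrite H; lra.
Qed.

(** * From finite covers of countably many parts to Hausdorff measure zero *)

Fixpoint concat_upto {A : Type} (L : nat -> list A) (n : nat) : list A :=
  match n with O => L O | S m => concat_upto L m ++ L (S m) end.

Lemma concat_upto_length {A : Type} (L : nat -> list A) (n : nat) :
  (forall m, (1 <= length (L m))%nat) -> (n < length (concat_upto L n))%nat.
Proof.
  intros H. induction n as [|n IH]; simpl; [apply H|]. rewrite length_app. specialize (H (S n)); lia.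
Qed.

(** Later concatenations only append, so reading the j-th entry at stage j defines one infinite
    sequence of pieces. *)
Lemma concat_upto_nth {A : Type} (L : nat -> list A) (d : A) (n m j : nat) :
  (n <= m)%nat -> (j < length (concat_upto L n))%nat ->
  nth j (concat_upto L m) d = nth j (concat_upto L n) d.
Proof.
  intros Hnm Hj. induction Hnm as [|m Hnm IH]; [reflexivity|].
  simpl. rewrite app_nth1; trivial.
  clear IH. induction Hnm as [|m Hnm IH]; trivial. simpl. rewrite length_app. lia.
Qed.

Lemma concat_upto_In {A : Type} (L : nat -> list A) (n : nat) (x : A) :
  In x (concat_upto L n) -> exists m, In x (L m).
Proof.
  induction n as [|n IH]; simpl; [eauto|]. intros H. apply in_app_or in H. destruct H; eauto.
Qed.

Lemma sum_n_nth_le_weight s l d m : (m < length l)%nat ->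
  sum_n (fun i => rpow (snd (nth i l d)) s) m <= weight s l.
Proof.
  revert m. induction l as [|p l IH]; intros m Hm; [simpl in Hm; lia|].
  destruct m as [|m].
  - rewrite sum_O. simpl. generalize (weight_ge_0 s l). lra.
  - unfold sum_n. rewrite sum_Sn_m by lia. rewrite <- sum_n_m_S. simpl nth.
    change (weight s (p :: l)) with (rpow (snd p) s + weight s l).
    change (plus ?x ?y) with (x + y). apply Rplus_le_compat_l. apply IH. simpl in Hm; lia.
Qed.

Lemma Sup_seq_ge (u : nat -> Rbar) (n : nat) : Rbar_le (u n) (Sup_seq u).
Proof. apply (proj1 (is_sup_seq_lub _ _ (Sup_seq_correct u))). now exists n. Qed.

Lemma Hdelta_ge_0 s delta A : Rbar_le (Finite 0) (Hdelta s delta A).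
Proof.
  unfold Hdelta. apply (proj2 (Glb_Rbar_correct _)). intros x (U & r & _ & Hx).
  change (Rbar_le (Finite 0) (Finite x)). rewrite <- Hx.
  apply Rbar_le_trans with (Finite (sum_n (fun i => rpow (r i) s) 0)).
  - rewrite sum_O. apply rpow_ge_0.
  - unfold cover_sum.
    apply (Sup_seq_ge (fun n => Finite (sum_n (fun i => rpow (r i) s) n))).
Qed.

(** A small weight forces small diameters: if the sum of the s-th powers is at most delta^s, every
    piece has size at most delta. Part p receives the budget eps / 2^(p+1). *)
Lemma Hmeas_countable_union (s : R) (A : C -> Prop) (Ap : nat -> C -> Prop) :
  0 < s ->
  (forall z, A z -> exists p, Ap p z) ->
  (forall p eps, 0 < eps -> scaled_cover (fun _ => 1) s (Ap p) eps) ->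
  Hmeas s A = Finite 0.
Proof.
  intros Hs HA Hcov.
  assert (Hd : forall delta, 0 < delta -> Hdelta s delta A = Finite 0).
  { intros delta Hdelta0. apply Rbar_le_antisym; [|apply Hdelta_ge_0].
    assert (Heps : forall eps : posreal, Rbar_le (Hdelta s delta A) (Finite eps)).
    { intros [eps0 Heps0]; simpl.
      set (eps := Rmin eps0 (rpow delta s)).
      assert (Heps : 0 < eps).
      { apply Rmin_pos; trivial. rewrite rpow_pos_eq; trivial. apply Rpower_pos. }
      assert (HL : forall p, exists l : list ((C -> Prop) * R), (1 <= length l)%nat /\
        (forall p, In p l -> 0 <= snd p /\
           forall z w, fst p z -> fst p w -> Cmod (Cminus z w) <= snd p) /\
        (forall z, Ap p z -> exists p, In p l /\ fst p z) /\
        weight s l <= eps * (/ 2) ^ (S p)).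
      { intros p. destruct (Hcov p (eps * (/ 2) ^ (S p))) as (l & H1 & H2 & H3).
        { apply Rmult_lt_0_compat; trivial. apply pow_lt; lra. }
        (* The empty piece of size 0 makes the list nonempty, as the enumeration requires; it has
           weight 0 by the convention in [rpow]. *)
        exists (((fun _ => False), 0) :: l). split; [simpl; lia|]. split; [|split].
        - intros p' [<-|Hp']; simpl; [split; [lra|tauto]|].
          destruct (H1 p' Hp') as [Ha Hb]. split; trivial. intros z w Hz Hw. specialize (Hb z w Hz Hw). lra.
        - intros z Hz. destruct (H2 z Hz) as (p' & Hp' & Hp''). exists p'. split; trivial. now right.
        - cbn [weight fold_right snd]. change (fold_right _ 0 l) with (weight s l).
          rewrite rpow_nonpos by lra. lra. }
      apply functional_choice in HL. destruct HL as (L & HL).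
      assert (Hlen : forall m, (1 <= length (L m))%nat) by (intros m; apply (HL m)).
      set (dflt := ((fun _ : C => False), 0) : (C -> Prop) * R).
      set (P := fun j => nth j (concat_upto L j) dflt).
      assert (HP : forall j m, (j <= m)%nat -> P j = nth j (concat_upto L m) dflt).
      { intros j m Hjm. symmetry. apply concat_upto_nth; trivial. now apply concat_upto_length. }
      assert (HPin : forall j, exists m, In (P j) (L m)).
      { intros j. apply concat_upto_In with j. apply nth_In. now apply concat_upto_length. }
      assert (Hsum : forall m, sum_n (fun i => rpow (snd (P i)) s) m <= eps).
      { intros m. rewrite (sum_n_ext_loc _ (fun i => rpow (snd (nth i (concat_upto L m) dflt)) s)).
        2:{ intros i Hi. now rewrite (HP i m). }
        apply Rle_trans with (1 := sum_n_nth_le_weight s _ dflt m (concat_upto_length L m Hlen)).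
        apply Rle_trans with (eps * (1 - (/ 2) ^ (S m))).
        - induction m as [|m IH]; simpl concat_upto.
          + destruct (HL O) as (_ & _ & _ & H). simpl in *. lra.
          + rewrite weight_app. destruct (HL (S m)) as (_ & _ & _ & H). simpl in *. lra.
        - assert (0 < (/ 2) ^ (S m)) by (apply pow_lt; lra). nra. }
      assert (Hsum' : exists x, cover_sum s (fun i => snd (P i)) = Finite x /\ x <= eps).
      { assert (Hub : Rbar_le (cover_sum s (fun i => snd (P i))) (Finite eps)).
        { unfold cover_sum. apply (proj2 (is_sup_seq_lub _ _ (Sup_seq_correct _))).
          intros x (n & ->). apply Hsum. }
        assert (Hlb : Rbar_le (Finite (sum_n (fun i => rpow (snd (P i)) s) 0)) (cover_sum s (fun i => snd (P i)))).
        { unfold cover_sum.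
          apply (Sup_seq_ge (fun n => Finite (sum_n (fun i => rpow (snd (P i)) s) n))). }
        destruct (cover_sum s (fun i => snd (P i))) as [x| |]; simpl in *; try tauto. eauto. }
      destruct Hsum' as (x & Hx & Hxe).
      apply Rbar_le_trans with (Finite x).
      2:{ apply Rle_trans with (1 := Hxe). apply Rmin_l. }
      apply (proj1 (Glb_Rbar_correct _)). exists (fun i => fst (P i)), (fun i => snd (P i)).
      split; trivial. split; [|split].
      - intros i. destruct (HPin i) as (m & Hm). split; [apply (HL m); trivial|].
        apply rpow_le_inv with s; trivial. apply Rle_trans with eps; [|apply Rmin_r].
        apply Rle_trans with (2 := Hsum i).
        destruct i as [|i]; [rewrite sum_O; lra|]. rewrite sum_Sn. change (plus ?x ?y) with (x + y).
        assert (0 <= sum_n (fun i => rpow (snd (P i)) s) i).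
        { rewrite <- (Rmult_0_r (INR (S i))). rewrite <- sum_n_const. apply sum_n_m_le. intros; apply rpow_ge_0. }
        lra.
      - intros i z w Hz Hw. destruct (HPin i) as (m & Hm).
        destruct (HL m) as (_ & H & _). apply (proj2 (H _ Hm)); trivial.
      - intros z Hz. destruct (HA z Hz) as (p & Hp). destruct (HL p) as (_ & _ & H & _).
        destruct (H z Hp) as (pc & Hpc & Hpz).
        assert (Hin : In pc (concat_upto L p)).
        { destruct p; simpl; trivial. apply in_or_app; now right. }
        apply (In_nth _ _ dflt) in Hin. destruct Hin as (j & Hj & Hjp).
        exists j. replace (P j) with pc; trivial. rewrite <- Hjp. unfold P.
        destruct (Nat.le_gt_cases j p) as [h|h].
        + apply concat_upto_nth; trivial. now apply concat_upto_length.
        + symmetry. apply concat_upto_nth; trivial. lia. }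
    destruct (Hdelta s delta A) as [x| |] eqn:Hx; simpl in *; trivial.
    - apply le_epsilon. intros e He. rewrite Rplus_0_l. apply (Heps (mkposreal e He)).
    - apply (Heps (mkposreal 1 Rlt_0_1)). }
  unfold Hmeas. apply is_sup_seq_unique.
  intros eps. split.
  - intros n. rewrite Hd; [simpl; generalize (cond_pos eps); lra|].
    apply Rinv_0_lt_compat. generalize (pos_INR n); lra.
  - exists O. rewrite Hd; [simpl; generalize (cond_pos eps); lra|].
    apply Rinv_0_lt_compat. simpl; lra.
Qed.

(** * The upper bound *)

Lemma Eiter_bounded (lam : nat -> C) (R0 : R) (j : nat) :
  exists M, forall z, Cmod z <= R0 -> Cmod (Eiter lam j z) <= M.
Proof.
  induction j as [|j (M & HM)]; [exists R0; now intros|].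
  exists (Cmod (lam (S j)) * exp M). intros z Hz. simpl. rewrite Cmod_E.
  apply Rmult_le_compat_l; [apply Cmod_ge_0|].
  generalize (Rle_abs (fst (Eiter lam j z))) (Rabs_Re_le_Cmod (Eiter lam j z)) (HM z Hz); intros.
  destruct (Rle_lt_or_eq_dec (fst (Eiter lam j z)) M) as [h|h]; [lra| |].
  - left; now apply exp_increasing.
  - rewrite h; lra.
Qed.

Lemma Eiter_bounded_below (lam : nat -> C) (R0 : R) (j : nat) :
  lam (S j) <> 0%C ->
  exists m, 0 < m /\ forall z, Cmod z <= R0 -> m <= Cmod (Eiter lam (S j) z).
Proof.
  intros Hl. destruct (Eiter_bounded lam R0 j) as (M & HM).
  assert (H0 : 0 < Cmod (lam (S j))) by now apply Cmod_gt_0.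
  exists (Cmod (lam (S j)) * exp (- M)). split.
  - apply Rmult_lt_0_compat; [trivial|apply exp_pos].
  - intros z Hz. simpl. rewrite Cmod_E. apply Rmult_le_compat_l; [lra|].
    generalize (Rle_abs (- fst (Eiter lam j z))) (Rabs_Re_le_Cmod (Eiter lam j z)) (HM z Hz).
    rewrite Rabs_Ropp. intros.
    destruct (Rle_lt_or_eq_dec (- M) (fst (Eiter lam j z))) as [h|h]; [lra| |].
    + left; now apply exp_increasing.
    + rewrite h; lra.
Qed.

Lemma prod1_pos (a : nat -> R) (n : nat) : (forall n, (1 <= n)%nat -> 0 < a n) -> 0 < prod1 a n.
Proof.
  intros H. induction n; simpl; [lra|]. apply Rmult_lt_0_compat; [trivial|apply H; lia].
Qed.

(** The single index [p] bounds the starting point, the time of entry into the annuli and the base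
    of the double exponential bound. [Good] marks the times at which that bound is known. *)
Definition bounded_part (lam : nat -> C) (a : nat -> R) (Good : nat -> Prop) (p : nat) (z : C) : Prop :=
  Cmod z <= INR p /\
  forall n, (p <= n)%nat ->
    a n <= Cmod (Eiter lam n z) /\ (Good n -> Cmod (Eiter lam n z) <= exp (INR p ^ n)).

Definition orbit_image (lam : nat -> C) (A : C -> Prop) (j : nat) (w : C) : Prop :=
  exists z, A z /\ Eiter lam j z = w.

Section Covering.

Variables (lam : nat -> C) (a : nat -> R) (Good : nat -> Prop) (s : R) (p : nat).
Hypothesis Hs : 1 < s.
Hypothesis Hlam : forall n, (1 <= n)%nat -> lam n <> 0%C.

Let A := bounded_part lam a Good p.
Let T := orbit_image lam A.

Lemma image_step (j : nat) (w : C) : T j w -> T (S j) (E (lam (S j)) w).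
Proof. intros (z & Hz & <-). exists z. split; trivial. Qed.

(** This makes the list of strips finite. K is not controlled as j grows, but [strips_sum_le] is
    uniform in it. *)
Lemma image_bounded (j : nat) : exists K : nat, forall w, T j w -> Cmod w < INR K.
Proof.
  destruct (Eiter_bounded lam (INR p) j) as (M & HM).
  destruct (nfloor_ex (Rmax M 0)) as (K & _ & HK); [apply Rmax_r|].
  exists (S K). intros w (z & [Hz _] & <-). rewrite S_INR.
  generalize (HM z Hz) (Rmax_l M 0); lra.
Qed.

Lemma cover_step_late (j : nat) (tau : R) :
  0 <= tau -> (p <= j)%nat -> 2 <= a j ->
  scaled_cover Cmod s (T (S j)) tau ->
  scaled_cover Cmod s (T j) (strip_const s * Rpower (a j) (1 - s) * tau).
Proof.
  intros Htau Hpj Haj H. destruct (image_bounded j) as (K & HK).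
  (* In the strip of index i the modulus is at least a_j and at least i, hence at least their
     mean. *)
  apply (scaled_cover_weaken Cmod s (T j) (T j)
    (strip_sum s (strips (fun i => (a j + INR i) / 2) K) * tau)); [trivial| |].
  { apply Rmult_le_compat_r; trivial. now apply strips_sum_le. }
  apply (scaled_cover_pullback Cmod s (lam (S j)) (T j) (T (S j))); trivial.
  - apply Hlam; lia.
  - intros k Hk. revert Hk. apply strips_pos. intros i. generalize (pos_INR i); lra.
  - intros w Hw. split; [now apply image_step|].
    destruct (strips_cover (fun i => (a j + INR i) / 2) K w) as (k & i & H1 & H2 & H3 & H4).
    { now apply HK. }
    exists k. repeat split; try apply H2; trivial. rewrite H3.
    destruct Hw as (z & [_ Hz] & <-). destruct (Hz j Hpj) as [Hz1 _]. lra.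
Qed.

(** Before time [p] the orbit need not lie above a_j, and only a crude positive lower bound for its
    modulus is at hand. The factor Q is fixed before tau, so finitely many such steps cost a
    constant that the choice of the final level can absorb. *)
Lemma cover_step_early (j : nat) : (1 <= j)%nat ->
  exists Q, 0 <= Q /\ forall tau, scaled_cover Cmod s (T (S j)) tau -> scaled_cover Cmod s (T j) (Q * tau).
Proof.
  intros Hj. destruct (image_bounded j) as (K & HK).
  destruct j as [|j]; [lia|].
  destruct (Eiter_bounded_below lam (INR p) j) as (m & Hm & Hmz); [apply Hlam; lia|].
  exists (strip_sum s (strips (fun _ => m) K)). split; [apply strip_sum_ge_0|].
  intros tau H.
  apply (scaled_cover_pullback Cmod s (lam (S (S j))) (T (S j)) (T (S (S j)))); trivial.
  - apply Hlam; lia.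
  - intros k Hk. revert Hk. apply strips_pos. trivial.
  - intros w Hw. split; [now apply image_step|].
    destruct (strips_cover (fun _ => m) K w) as (k & i & H1 & H2 & H3 & H4).
    { now apply HK. }
    exists k. repeat split; try apply H2; trivial. rewrite H3.
    destruct Hw as (z & [Hz _] & <-). now apply Hmz.
Qed.

(** The starting point may be close to 0, so sizes at level 0 are not taken relative to |z|; the
    normalisation 1 gives the diameters that Hausdorff measure needs. *)
Lemma cover_first :
  exists Q, 0 <= Q /\ forall tau, scaled_cover Cmod s (T 1) tau -> scaled_cover (fun _ => 1) s A (Q * tau).
Proof.
  destruct (image_bounded 0) as (K & HK).
  exists (strip_sum s (strips (fun _ => 1) K)). split; [apply strip_sum_ge_0|].
  intros tau H.
  apply (scaled_cover_pullback (fun _ => 1) s (lam 1) A (T 1)); trivial.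
  - apply Hlam; lia.
  - intros k Hk. revert Hk. apply strips_pos. intros; lra.
  - intros w Hw. assert (Hw0 : T 0 w) by (now exists w). split; [now apply (image_step 0)|].
    destruct (strips_cover (fun _ => 1) K w) as (k & i & H1 & H2 & H3 & H4).
    { now apply HK. }
    exists k. repeat split; try apply H2; trivial. rewrite H3; lra.
Qed.

Lemma cover_early (j : nat) :
  exists Q, 0 <= Q /\ forall tau, scaled_cover Cmod s (T (S j)) tau -> scaled_cover (fun _ => 1) s A (Q * tau).
Proof.
  induction j as [|j (Q & HQ & IH)]; [apply cover_first|].
  destruct (cover_step_early (S j)) as (Q' & HQ' & H); [lia|].
  exists (Q * Q'). split; [now apply Rmult_le_pos|].
  intros tau Ht. rewrite Rmult_assoc. apply IH, H, Ht.
Qed.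

(** Levels j+1 to j+m are pulled through, so the quotient of products is a_(j+1) ... a_(j+m); the
    cover itself starts one level higher, at S j + m. *)
Lemma cover_late (j m : nat) (tau : R) :
  0 <= tau -> (p <= S j)%nat -> (forall n, (S j <= n)%nat -> 2 <= a n) ->
  (forall n, (1 <= n)%nat -> 0 < a n) ->
  scaled_cover Cmod s (T (S j + m)) tau ->
  scaled_cover Cmod s (T (S j))
    (strip_const s ^ m * Rpower (prod1 a (j + m) / prod1 a j) (1 - s) * tau).
Proof.
  intros Htau Hpj Ha Ha0. revert tau Htau. induction m as [|m IH]; intros tau Htau H.
  - rewrite Nat.add_0_r in *. generalize (prod1_pos a j Ha0); intros.
    replace (prod1 a j / prod1 a j) with 1 by (field; lra).
    unfold Rpower at 1. rewrite ln_1, Rmult_0_r, exp_0, Rmult_1_r. simpl. now rewrite Rmult_1_l.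
  - replace (S j + S m)%nat with (S (S j + m)) in H by lia.
    apply cover_step_late in H; [|trivial|lia|apply Ha; lia].
    apply IH in H.
    2:{ apply Rmult_le_pos; trivial. apply Rmult_le_pos; left; [now apply strip_const_pos|apply Rpower_pos]. }
    eapply scaled_cover_weaken; [| |exact H]; [trivial|]. right.
    replace (j + S m)%nat with (S (j + m)) by lia. simpl prod1.
    replace (S j + m)%nat with (S (j + m)) by lia.
    generalize (prod1_pos a j Ha0) (prod1_pos a (j + m) Ha0); intros H1 H2.
    replace (prod1 a (j + m) * a (S (j + m)) / prod1 a j)
      with (prod1 a (j + m) / prod1 a j * a (S (j + m))) by (field; lra).
    rewrite <- Rpower_mult_distr; [simpl; ring|now apply Rdiv_lt_0_compat|apply Ha0; lia].
Qed.

Lemma image_cover (n : nat) :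
  Good n -> (p <= n)%nat -> 1 <= a n ->
  scaled_cover Cmod s (T n) ((INR p ^ n + 1) * Rpower 4 s).
Proof.
  intros HG Hpn Han.
  eapply scaled_cover_weaken; [| |apply (annulus_cover s (p ^ n + 1))].
  - intros w (z & [_ Hz] & <-). destruct (Hz n Hpn) as [H1 H2]. specialize (H2 HG).
    split; [lra|]. apply Rle_lt_trans with (1 := H2). apply exp_increasing.
    rewrite plus_INR, pow_INR. simpl; lra.
  - rewrite plus_INR, pow_INR. simpl; lra.
Qed.

Lemma bounded_part_cover (eps : R) :
  (forall n, (1 <= n)%nat -> 0 < a n) ->
  (forall K, 0 < K -> exists N, forall n, (N <= n)%nat -> K ^ n <= prod1 a n) ->
  (exists N, forall n, (N <= n)%nat -> 2 <= a n) ->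
  (forall N, exists n, (N <= n)%nat /\ Good n) ->
  0 < eps -> scaled_cover (fun _ => 1) s A eps.
Proof.
  intros Ha0 Hgrow (N0 & HN0) HGood Heps.
  set (j := max N0 p).
  destruct (cover_early j) as (Q & HQ & Hearly).
  generalize (strip_const_pos s Hs); set (G := strip_const s); intros HG.
  (* [P] replaces [p], which may be 0; since P >= 1, its powers also absorb the added 1 in the
     number of rings. *)
  set (P := INR p + 1).
  assert (HP : 1 <= P) by (unfold P; generalize (pos_INR p); lra).
  (* Up to constants, G^n comes from the strips and P^n from the rings at the final level. [K]
     satisfies K^(1-s) = 1 / B, so the growth of the product cancels both and leaves 2^(-n); [W]
     will collect the factors independent of n. *)
  set (B := 2 * G * P). assert (HB : 0 < B) by (unfold B; nra).
  set (K := Rpower B (/ (s - 1))).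
  assert (HKB : Rpower K (1 - s) = / B).
  { unfold K. rewrite Rpower_mult. replace (/ (s - 1) * (1 - s)) with (Ropp 1) by (field; lra).
    rewrite Rpower_Ropp, Rpower_1; trivial. }
  destruct (Hgrow K) as (N1 & HN1); [apply Rpower_pos|].
  set (c := prod1 a j). assert (Hc : 0 < c) by now apply prod1_pos.
  set (W := Q * (Rpower (/ c) (1 - s) * (/ (G ^ j) * (2 * P * Rpower 4 s)))).
  assert (HW : 0 <= W).
  { assert (0 < / G ^ j) by now apply Rinv_0_lt_compat, pow_lt.
    generalize (Rpower_pos (/ c) (1 - s)) (Rpower_pos 4 s); intros.
    unfold W. apply Rmult_le_pos; trivial. apply Rmult_le_pos; [lra|].
    apply Rmult_le_pos; [lra|]. apply Rmult_le_pos; lra. }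
  destruct (pow_lt_1_zero (/ 2)) with (y := eps / (W + 1)) as (N2 & HN2).
  { rewrite Rabs_right; lra. }
  { apply Rdiv_lt_0_compat; lra. }
  destruct (HGood (S (j + N1 + N2))) as (n' & Hn' & Hgood).
  (* The rings live at the good level n', and the last level pulled through is n = n' - 1. *)
  set (n := (n' - 1)%nat). assert (En' : n' = S n) by (unfold n; lia).
  set (m := (n - j)%nat). assert (En : n = (j + m)%nat) by (unfold m; lia).
  assert (Himg : scaled_cover Cmod s (T (S j + m)) ((INR p ^ n' + 1) * Rpower 4 s)).
  { replace (S j + m)%nat with n' by lia. apply image_cover; trivial; [lia|].
    assert (2 <= a n') by (apply HN0; lia). lra. }
  apply cover_late in Himg; trivial; [| |lia|intros; apply HN0; lia].
  2:{ apply Rmult_le_pos; [|left; apply Rpower_pos].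
      assert (0 <= INR p ^ n') by (apply pow_le, pos_INR). lra. }
  apply Hearly in Himg.
  eapply scaled_cover_weaken; [| |exact Himg]; [trivial|].
  rewrite <- En. fold c G.
  assert (HR : Rpower (prod1 a n / c) (1 - s) <= Rpower (/ c) (1 - s) * (/ B) ^ n).
  { assert (HKn : 0 < K ^ n) by (apply pow_lt, Rpower_pos).
    assert (Hprod : K ^ n <= prod1 a n) by (apply HN1; lia).
    unfold Rdiv. rewrite Rmult_comm, <- Rpower_mult_distr; [|now apply Rinv_0_lt_compat|lra].
    apply Rmult_le_compat_l; [left; apply Rpower_pos|].
    rewrite <- HKB, <- Rpower_pow by apply Rpower_pos.
    rewrite Rpower_mult, (Rmult_comm (1 - s)), <- Rpower_mult.
    rewrite (Rpower_pow n K) by apply Rpower_pos.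
    replace (1 - s) with (- (s - 1)) by ring. rewrite !Rpower_Ropp.
    apply Rinv_le_contravar; [apply Rpower_pos|]. apply Rle_Rpower_l; [lra|split; trivial]. }
  assert (HGm : G ^ m = / G ^ j * G ^ n).
  { rewrite En, pow_add. field. apply pow_nonzero; lra. }
  assert (HPn : INR p ^ n' + 1 <= 2 * P * P ^ n).
  { rewrite En'. simpl.
    assert (0 <= INR p ^ n) by (apply pow_le, pos_INR).
    assert (INR p ^ n <= P ^ n) by (apply pow_incr; unfold P; generalize (pos_INR p); lra).
    assert (1 <= P ^ n) by (now apply pow_R1_Rle).
    assert (INR p <= P) by (unfold P; lra). generalize (pos_INR p). nra. }
  apply Rle_trans with (W * (/ 2) ^ n).
  - unfold W. rewrite !Rmult_assoc. apply Rmult_le_compat_l; trivial.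
    rewrite HGm.
    apply Rle_trans with (/ G ^ j * G ^ n * (Rpower (/ c) (1 - s) * (/ B) ^ n * (2 * P * P ^ n * Rpower 4 s))).
    + rewrite !Rmult_assoc.
      assert (0 < / G ^ j) by (apply Rinv_0_lt_compat, pow_lt; lra).
      assert (0 < G ^ n) by (apply pow_lt; lra).
      apply Rmult_le_compat_l; [lra|]. apply Rmult_le_compat_l; [lra|].
      rewrite <- (Rmult_assoc (Rpower (/ c) (1 - s))).
      assert (0 <= INR p ^ n') by (apply pow_le, pos_INR).
      apply Rmult_le_compat; [left; apply Rpower_pos| |trivial|].
      * apply Rmult_le_pos; [lra|left; apply Rpower_pos].
      * rewrite <- !Rmult_assoc. apply Rmult_le_compat_r; [left; apply Rpower_pos|lra].
    + right. replace ((/ 2) ^ n) with (G ^ n * (/ B) ^ n * P ^ n).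
      2:{ rewrite <- !Rpow_mult_distr. f_equal. unfold B. field. lra. }
      ring.
  - assert (Hpow : (/ 2) ^ n < eps / (W + 1)).
    { apply Rle_lt_trans with (1 := Rle_abs _). apply HN2. lia. }
    apply Rle_trans with (W * (eps / (W + 1))); [apply Rmult_le_compat_l; lra|].
    apply Rle_trans with ((W + 1) * (eps / (W + 1))); [apply Rmult_le_compat_r; [|lra]|right; field; lra].
    left; apply Rdiv_lt_0_compat; lra.
Qed.

End Covering.

Lemma Hmeas_upper (lam : nat -> C) (a : nat -> R) (Good : nat -> Prop) (s : R) (S0 : C -> Prop) :
  1 < s ->
  (forall n, (1 <= n)%nat -> lam n <> 0%C) ->
  (forall n, (1 <= n)%nat -> 0 < a n) ->
  (forall K, 0 < K -> exists N, forall n, (N <= n)%nat -> K ^ n <= prod1 a n) ->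
  (exists N, forall n, (N <= n)%nat -> 2 <= a n) ->
  (forall N, exists n, (N <= n)%nat /\ Good n) ->
  (forall z, S0 z -> exists N C0, forall n, (N <= n)%nat ->
     a n <= Cmod (Eiter lam n z) /\ (Good n -> Cmod (Eiter lam n z) <= exp (C0 ^ n))) ->
  Hmeas s S0 = Finite 0.
Proof.
  intros Hs Hlam Ha0 Hgrow Ha Hgood HS.
  apply Hmeas_countable_union with (Ap := bounded_part lam a Good); [lra| |].
  - intros z Hz. destruct (HS z Hz) as (N & C0 & H).
    destruct (nfloor_ex (Cmod z + Rabs C0)) as (k & _ & Hk).
    { generalize (Cmod_ge_0 z) (Rabs_pos C0); lra. }
    exists (max N (S k)). split.
    + apply Rle_trans with (INR (S k)); [|apply le_INR; lia].
      rewrite S_INR. generalize (Rabs_pos C0); lra.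
    + intros n Hn. destruct (H n ltac:(lia)) as [H1 H2]. split; trivial.
      intros HG. apply Rle_trans with (1 := H2 HG).
      assert (H3 : C0 ^ n <= INR (max N (S k)) ^ n).
      { apply Rle_trans with (Rabs C0 ^ n).
        - rewrite RPow_abs. apply Rle_abs.
        - apply pow_incr. split; [apply Rabs_pos|].
          apply Rle_trans with (INR (S k)); [|apply le_INR; lia].
          rewrite S_INR. generalize (Cmod_ge_0 z); lra. }
      destruct H3 as [h|h]; [left; now apply exp_increasing|rewrite h; lra].
  - intros p eps Heps. now apply bounded_part_cover.
Qed.

(** * Covers of the unit interval and mixed radix expansions *)

(** For x, l >= 0, the length of the part of [c - l, c + l] inside [0, x]. *)
Definition overlap (c l x : R) : R := Rmax 0 (Rmin x (c + l) - Rmax 0 (c - l)).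

Lemma overlap_incr c l x y : x <= y -> overlap c l x <= overlap c l y.
Proof.
  intros H. unfold overlap, Rmax, Rmin.
  repeat destruct (Rle_dec _ _); lra.
Qed.

Lemma overlap_full c l x y : 0 <= x -> c - l <= x -> x <= y -> y <= c + l ->
  overlap c l x + (y - x) <= overlap c l y.
Proof.
  intros H0 H1 H2 H3. unfold overlap, Rmax, Rmin.
  repeat destruct (Rle_dec _ _); lra.
Qed.

Lemma overlap_le c l x : 0 <= l -> overlap c l x <= 2 * l.
Proof.
  intros H. unfold overlap, Rmax, Rmin. repeat destruct (Rle_dec _ _); lra.
Qed.

Lemma sum_n_bump (f g : nat -> R) (i m : nat) (h : R) :
  (forall j, f j <= g j) -> (i <= m)%nat -> f i + h <= g i -> sum_n f m + h <= sum_n g m.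
Proof.
  intros Hfg Hi Hh. induction m as [|m IH].
  - replace i with O in Hh by lia. rewrite !sum_O. lra.
  - rewrite !sum_Sn. change (plus ?x ?y) with (x + y).
    destruct (Nat.eq_dec i (S m)) as [->|Hn].
    + assert (sum_n f m <= sum_n g m) by (apply sum_n_m_le; trivial). lra.
    + specialize (IH ltac:(lia)). specialize (Hfg (S m)). lra.
Qed.

Lemma sum_n_incr (f : nat -> R) (m m' : nat) :
  (forall j, 0 <= f j) -> (m <= m')%nat -> sum_n f m <= sum_n f m'.
Proof.
  intros Hf H. induction H as [|m' H IH]; [lra|]. rewrite sum_Sn.
  change (plus ?x ?y) with (x + y). specialize (Hf (S m')). lra.
Qed.

(** A supremum argument in the style of Heine-Borel. If the intervals covered [0, 1/2], the points x
    for which finitely many of them have total overlap with [0, x] almost x would reach up to 1/2,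
    against the bound on the total length. *)
Lemma centered_intervals_no_cover (c l : nat -> R) :
  (forall i, 0 <= l i) -> (forall m, sum_n l m <= / 8) ->
  exists x, 0 <= x <= / 2 /\ forall i, ~ (c i - l i < x < c i + l i).
Proof.
  intros Hl Hsum. apply NNPP. intros Hno.
  assert (Hcov : forall x, 0 <= x <= / 2 -> exists i, c i - l i < x < c i + l i).
  { intros x Hx. apply NNPP. intros Hx'. apply Hno. exists x. split; trivial.
    intros i Hi. apply Hx'. now exists i. }
  set (F := fun m x => sum_n (fun i => overlap (c i) (l i) x) m).
  set (Reached := fun x => 0 <= x <= / 2 /\ forall eta, 0 < eta -> exists m, x - eta <= F m x).
  assert (Hov : forall i x, 0 <= overlap (c i) (l i) x) by (intros; apply Rmax_l).
  assert (S0 : Reached 0).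
  { split; [lra|]. intros eta He. exists O. unfold F. rewrite sum_O.
    generalize (Hov O 0); lra. }
  destruct (completeness Reached) as (sg & Hub & Hlub).
  { exists (/ 2). intros x [Hx _]; lra. }
  { now exists 0. }
  assert (Hsg : 0 <= sg <= / 2).
  { split; [now apply Hub|]. apply Hlub. intros x [Hx _]; lra. }
  destruct (Hcov sg Hsg) as (i & Hi1 & Hi2).
  assert (Hx : exists x, Reached x /\ c i - l i < x).
  { apply NNPP. intros Hx. assert (sg <= c i - l i); [|lra].
    apply Hlub. intros x HSx. destruct (Rle_lt_dec x (c i - l i)); trivial.
    exfalso; apply Hx; eauto. }
  destruct Hx as (x & HSx & Hcx).
  assert (Hxs : x <= sg) by now apply Hub.
  destruct HSx as [Hx0 HSx].
  assert (HSy : forall y, x <= y -> y <= / 2 -> y <= c i + l i -> Reached y).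
  { intros y Hxy Hy Hyc. split; [lra|]. intros eta He.
    destruct (HSx eta He) as (m & Hm). exists (max m i).
    assert (F m x <= F (max m i) x) by (apply sum_n_incr; [intros; apply Hov|lia]).
    assert (F (max m i) x + (y - x) <= F (max m i) y); [|lra].
    apply (sum_n_bump (fun i => overlap (c i) (l i) x) (fun i => overlap (c i) (l i) y) i);
      [intros; now apply overlap_incr|lia|]. apply overlap_full; lra. }
  (* Below 1/2, the interval around [sg] would push [Reached] past its supremum. At 1/2 the overlaps
     add up to at most 2/8, short of 1/2 - 1/8. *)
  destruct (Rlt_le_dec sg (/ 2)) as [h|h].
  - assert (Hy : Reached (Rmin (/ 2) (c i + l i))).
    { apply HSy; [apply Rmin_glb; lra|apply Rmin_l|apply Rmin_r]. }
    apply Hub in Hy. revert Hy. apply Rmin_case; lra.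
  - assert (Hy : Reached (/ 2)) by (apply HSy; lra).
    destruct Hy as [_ Hy]. destruct (Hy (/ 8)) as (m & Hm); [lra|].
    assert (F m (/ 2) <= 2 * sum_n l m).
    { unfold F. clear Hm. induction m as [|m IH].
      - rewrite !sum_O. apply overlap_le, Hl.
      - rewrite !sum_Sn. change plus with Rplus.
        generalize (overlap_le (c (S m)) _ (/ 2) (Hl (S m))). lra. }
    specialize (Hsum m). lra.
Qed.

Lemma small_sets_no_cover (V : nat -> R -> Prop) (d : nat -> R) :
  (forall i, 0 <= d i) ->
  (forall i x y, V i x -> V i y -> Rabs (x - y) <= d i) ->
  (forall m, sum_n d m <= / 16) ->
  exists x, 0 <= x < 1 /\ forall i, ~ V i x.
Proof.
  intros Hd HV Hsum.
  assert (Hc : forall i, exists c, forall x, V i x -> Rabs (x - c) <= d i).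
  { intros i. destruct (classic (exists c, V i c)) as [(c & Hc)|Hc].
    - exists c. intros x Hx. now apply HV.
    - exists 0. intros x Hx. exfalso; eauto. }
  apply functional_choice in Hc. destruct Hc as (c & Hc).
  (* The summable enlargement puts each set, even one of diameter 0, into an open interval; it adds
     at most 1/16 to the sum of the radii. *)
  destruct (centered_intervals_no_cover c (fun i => d i + / 16 * (/ 2) ^ (S i))) as (x & Hx & Hn).
  - intros i. specialize (Hd i). assert (0 < (/ 2) ^ S i) by (apply pow_lt; lra). lra.
  - intros m. specialize (Hsum m).
    assert (sum_n (fun i => d i + / 16 * (/ 2) ^ S i) m = sum_n d m + / 16 * (1 - (/ 2) ^ S m)).
    { clear Hsum. induction m as [|m IH]; [rewrite !sum_O; simpl; lra|].
      rewrite !sum_Sn, IH. change plus with Rplus. simpl. lra. }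
    assert (0 < (/ 2) ^ S m) by (apply pow_lt; lra). lra.
  - exists x. split; [lra|]. intros i Hi. apply (Hn i). specialize (Hc i x Hi).
    apply Rabs_le_between' in Hc. assert (0 < (/ 2) ^ S i) by (apply pow_lt; lra). lra.
Qed.

(** The m-th remainder of the Cantor series x = sum of d_m / (N_0 ... N_m); the digit d_m is the
    integer part dropped on passing to the next remainder. *)
Fixpoint radix_rest (N : nat -> nat) (x : R) (m : nat) : R :=
  match m with O => x | S m => frac_part (INR (N m) * radix_rest N x m) end.

Definition radix_digit (N : nat -> nat) (x : R) (m : nat) : nat :=
  Z.to_nat (Int_part (INR (N m) * radix_rest N x m)).

Fixpoint radix_prod (N : nat -> nat) (m : nat) : R :=
  match m with O => 1 | S m => radix_prod N m * INR (N m) end.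

Lemma radix_rest_bound N x m : 0 <= x < 1 -> 0 <= radix_rest N x m < 1.
Proof.
  intros Hx. destruct m as [|m]; simpl; trivial.
  destruct (base_fp (INR (N m) * radix_rest N x m)); lra.
Qed.

Lemma radix_digit_eq N x m : 0 <= x < 1 ->
  INR (radix_digit N x m) = INR (N m) * radix_rest N x m - radix_rest N x (S m).
Proof.
  intros Hx. unfold radix_digit. simpl. unfold frac_part.
  set (y := INR (N m) * radix_rest N x m).
  assert (Hy : 0 <= y).
  { apply Rmult_le_pos; [apply pos_INR|]. now apply (radix_rest_bound N x m). }
  assert (Hz : (0 <= Int_part y)%Z).
  { destruct (base_Int_part y) as [_ H]. apply le_IZR. 
    assert (-1 < IZR (Int_part y)) by lra. assert (-1 < Int_part y)%Z by now apply lt_IZR.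
    apply IZR_le. lia. }
  rewrite INR_IZR_INZ, Z2Nat.id by trivial. ring.
Qed.

Lemma radix_digit_lt N x m : (1 <= N m)%nat -> 0 <= x < 1 -> (radix_digit N x m < N m)%nat.
Proof.
  intros HN Hx. apply INR_lt. rewrite radix_digit_eq by trivial.
  generalize (radix_rest_bound N x m Hx) (radix_rest_bound N x (S m) Hx).
  assert (1 <= INR (N m)) by (change 1 with (INR 1); now apply le_INR). nra.
Qed.

Lemma radix_prod_ge N m : (forall m, (2 <= N m)%nat) -> 2 ^ m <= radix_prod N m.
Proof.
  intros HN. induction m as [|m IH]; simpl; [lra|].
  assert (2 <= INR (N m)) by (change 2 with (INR 2); now apply le_INR).
  assert (0 < 2 ^ m) by (apply pow_lt; lra). nra.
Qed.

Lemma radix_common_prefix N x y m : (forall m, (2 <= N m)%nat) -> 0 <= x < 1 -> 0 <= y < 1 ->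
  (forall j, (j < m)%nat -> radix_digit N x j = radix_digit N y j) ->
  radix_prod N m * (x - y) = radix_rest N x m - radix_rest N y m.
Proof.
  intros HN Hx Hy. induction m as [|m IH]; intros H; [simpl; ring|].
  cbn [radix_prod]. specialize (IH ltac:(intros; apply H; lia)).
  replace (radix_prod N m * INR (N m) * (x - y)) with (INR (N m) * (radix_prod N m * (x - y))) by ring.
  rewrite IH. specialize (H m ltac:(lia)). apply (f_equal INR) in H.
  rewrite !radix_digit_eq in H by trivial. lra.
Qed.

(** At the first differing digit the scaled difference is the digit difference plus a difference of
    remainders in [0, 1), hence the extra 1. Distinct points do differ in some digit, since the
    products grow at least like 2^m. *)
Lemma radix_separation N x y : (forall m, (2 <= N m)%nat) -> 0 <= x < 1 -> 0 <= y < 1 -> x <> y ->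
  exists m, radix_digit N x m <> radix_digit N y m /\
    radix_prod N (S m) * Rabs (x - y) <= Rabs (INR (radix_digit N x m) - INR (radix_digit N y m)) + 1.
Proof.
  intros HN Hx Hy Hxy.
  assert (Hdiff : exists m, radix_digit N x m <> radix_digit N y m).
  { apply NNPP. intros Hno.
    assert (Heq : forall m, radix_digit N x m = radix_digit N y m).
    { intros m. destruct (Nat.eq_dec (radix_digit N x m) (radix_digit N y m)); trivial.
      exfalso; eauto. }
    assert (Hd : 0 < Rabs (x - y)) by (apply Rabs_pos_lt; lra).
    destruct (Pow_x_infinity 2 ltac:(rewrite Rabs_right; lra) (2 / Rabs (x - y))) as (m & Hm).
    specialize (Hm m (le_n m)). rewrite Rabs_right in Hm by (left; apply pow_lt; lra).
    generalize (radix_common_prefix N x y m HN Hx Hy (fun j _ => Heq j)); intros H.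
    generalize (radix_rest_bound N x m Hx) (radix_rest_bound N y m Hy); intros.
    assert (Hlt : radix_prod N m * Rabs (x - y) < 2).
    { rewrite <- (Rabs_right (radix_prod N m)).
      - rewrite <- Rabs_mult, H. apply Rabs_def1; lra.
      - apply Rle_ge. apply Rle_trans with (2 ^ m); [apply pow_le; lra|now apply radix_prod_ge]. }
    generalize (radix_prod_ge N m HN); intros Hge.
    assert (2 / Rabs (x - y) * Rabs (x - y) = 2) by (field; lra). nra. }
  destruct Hdiff as (n & Hn).
  assert (Hleast : exists m, radix_digit N x m <> radix_digit N y m /\
     forall j, (j < m)%nat -> radix_digit N x j = radix_digit N y j).
  { induction n as [n IH] using lt_wf_ind.
    destruct (classic (exists j, (j < n)%nat /\ radix_digit N x j <> radix_digit N y j)) as [(j & Hj & Hj')|Hno].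
    - eapply IH; eauto.
    - exists n. split; trivial. intros j Hj. apply NNPP. eauto. }
  destruct Hleast as (m & Hm & Hpre). exists m. split; trivial.
  generalize (radix_common_prefix N x y m HN Hx Hy Hpre); intros H.
  cbn [radix_prod].
  assert (HP : 0 <= radix_prod N m * INR (N m)).
  { apply Rmult_le_pos; [|apply pos_INR]. apply Rle_trans with (2 ^ m); [apply pow_le; lra|now apply radix_prod_ge]. }
  rewrite <- (Rabs_right (radix_prod N m * INR (N m))) by lra. rewrite <- Rabs_mult.
  replace (radix_prod N m * INR (N m) * (x - y)) with (INR (N m) * (radix_prod N m * (x - y))) by ring.
  rewrite H, !radix_digit_eq by trivial.
  generalize (radix_rest_bound N x (S m) Hx) (radix_rest_bound N y (S m) Hy); intros.
  set (A := INR (N m) * radix_rest N x m) in *. set (B := INR (N m) * radix_rest N y m) in *.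
  set (a := radix_rest N x (S m)) in *. set (b := radix_rest N y (S m)) in *.
  replace (INR (N m) * (radix_rest N x m - radix_rest N y m)) with ((A - a - (B - b)) + (a - b)) by (unfold A, B; ring).
  apply Rle_trans with (1 := Rabs_triang _ _). apply Rplus_le_compat_l. apply Rabs_le; lra.
Qed.

(** * Orbits with prescribed boxes *)

(** The intervals of radius 2 M / 2^d around u_d are nested, so the supremum of their left ends lies
    in all of them. *)
Lemma dyadic_limit (u : nat -> R) (M : R) :
  (forall d, Rabs (u (S d) - u d) <= M * (/ 2) ^ d) ->
  exists l, forall d, Rabs (l - u d) <= 2 * M * (/ 2) ^ d.
Proof.
  intros H.
  set (lo := fun d => u d - 2 * M * (/ 2) ^ d). set (hi := fun d => u d + 2 * M * (/ 2) ^ d).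
  assert (Hstep : forall d, lo d <= lo (S d) /\ hi (S d) <= hi d).
  { intros d. generalize (H d); intros Hd. apply Rabs_le_between' in Hd.
    unfold lo, hi. simpl. lra. }
  assert (HM : 0 <= M).
  { specialize (H O). simpl in H. generalize (Rabs_pos (u 1%nat - u O)). lra. }
  assert (Hlh : forall d, lo d <= hi d).
  { intros d. unfold lo, hi. assert (0 < (/ 2) ^ d) by (apply pow_lt; lra). nra. }
  assert (Hlo : forall d e, (d <= e)%nat -> lo d <= lo e).
  { intros d e Hde. induction Hde as [|e Hde IH]; [lra|]. generalize (proj1 (Hstep e)); lra. }
  assert (Hhi : forall d e, (d <= e)%nat -> hi e <= hi d).
  { intros d e Hde. induction Hde as [|e Hde IH]; [lra|]. generalize (proj2 (Hstep e)); lra. }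
  assert (Hcross : forall d e, lo d <= hi e).
  { intros d e. apply Rle_trans with (lo (max d e)); [apply Hlo; lia|].
    apply Rle_trans with (hi (max d e)); [apply Hlh|apply Hhi; lia]. }
  destruct (completeness (fun x => exists d, x = lo d)) as (l & Hub & Hlub).
  { exists (hi O). intros x (d & ->). apply Hcross. }
  { exists (lo O). now exists O. }
  exists l. intros d. apply Rabs_le_between'.
  assert (lo d <= l) by (apply Hub; now exists d).
  assert (l <= hi d) by (apply Hlub; intros x (e & ->); apply Hcross).
  unfold lo, hi in *. lra.
Qed.

Lemma dyadic_limit_C (u : nat -> C) (M : R) :
  (forall d, Cmod (Cminus (u (S d)) (u d)) <= M * (/ 2) ^ d) ->
  exists l, forall d, Cmod (Cminus l (u d)) <= 4 * M * (/ 2) ^ d.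
Proof.
  intros H.
  destruct (dyadic_limit (fun d => fst (u d)) M) as (x & Hx).
  { intros d. apply Rle_trans with (2 := H d). apply (Rabs_Re_le_Cmod (Cminus (u (S d)) (u d))). }
  destruct (dyadic_limit (fun d => snd (u d)) M) as (y & Hy).
  { intros d. apply Rle_trans with (2 := H d). apply (Rabs_Im_le_Cmod (Cminus (u (S d)) (u d))). }
  exists (x, y). intros d. apply Rle_trans with (1 := Cmod_le_Rabs _).
  change (fst (Cminus (x, y) (u d))) with (x - fst (u d)).
  change (snd (Cminus (x, y) (u d))) with (y - snd (u d)).
  generalize (Hx d) (Hy d); lra.
Qed.

Lemma le_dyadic_le_0 (x M : R) : (forall d, x <= M * (/ 2) ^ d) -> x <= 0.
Proof.
  intros H. apply Rnot_lt_le. intros Hx.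
  assert (HM : 0 < M) by (specialize (H O); simpl in H; lra).
  destruct (pow_lt_1_zero (/ 2)) with (y := x / M) as (N & HN).
  { rewrite Rabs_right; lra. }
  { now apply Rdiv_lt_0_compat. }
  specialize (HN N (le_n N)). specialize (H N). rewrite Rabs_right in HN by (left; apply pow_lt; lra).
  assert (M * (/ 2) ^ N < M * (x / M)) by now apply Rmult_lt_compat_l.
  replace (M * (x / M)) with x in * by (field; lra). lra.
Qed.

(** Right inverses of the maps, chosen on the boxes, halve distances. The common size bound D makes
    their compositions converge at a rate uniform in n, and the boxes, being closed, contain the
    limits. *)
Lemma backward_contraction_orbit (F : nat -> C -> C) (x1 x2 y1 y2 : nat -> R) (D : R) :
  let B n (z : C) := x1 n <= fst z <= x2 n /\ y1 n <= snd z <= y2 n in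
  (forall n, x1 n <= x2 n) -> (forall n, y1 n <= y2 n) ->
  (forall n, x2 n - x1 n + (y2 n - y1 n) <= D) ->
  (forall n w, B (S n) w -> exists u, B n u /\ F n u = w) ->
  (forall n u v, B n u -> B n v -> B (S n) (F n u) -> B (S n) (F n v) ->
     2 * Cmod (Cminus u v) <= Cmod (Cminus (F n u) (F n v))) ->
  exists zeta : nat -> C, forall n, B n (zeta n) /\ F n (zeta n) = zeta (S n).
Proof.
  intros B Hx Hy HD Hsurj Hexp.
  assert (HL : forall p : nat * C, exists u, B (S (fst p)) (snd p) -> B (fst p) u /\ F (fst p) u = snd p).
  { intros [n w]. simpl. destruct (classic (B (S n) w)) as [h|h].
    - destruct (Hsurj n w h) as (u & Hu). now exists u.
    - exists w. tauto. }
  apply functional_choice in HL. destruct HL as (L0 & HL0).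
  set (L := fun n w => L0 (n, w)).
  assert (HL : forall n w, B (S n) w -> B n (L n w) /\ F n (L n w) = w) by (intros n w; apply (HL0 (n, w))).
  assert (Hcontr : forall n w w', B (S n) w -> B (S n) w' ->
    2 * Cmod (Cminus (L n w) (L n w')) <= Cmod (Cminus w w')).
  { intros n w w' Hw Hw'. destruct (HL n w Hw) as [H1 H2]. destruct (HL n w' Hw') as [H1' H2'].
    rewrite <- H2, <- H2' at 2. apply Hexp; trivial; [now rewrite H2|now rewrite H2']. }
  (* [approx d n] starts from a corner of the box at level n + d and applies d inverses down to
     level n. *)
  set (approx := fix approx d n {struct d} := match d with
                 | O => (x1 n, y1 n) : C | S d => L n (approx d (S n)) end).
  assert (HB : forall d n, B n (approx d n)).
  { induction d as [|d IH]; intros n; simpl.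
    - split; simpl; [generalize (Hx n)|generalize (Hy n)]; lra.
    - apply HL, IH. }
  assert (Hstep : forall d n, Cmod (Cminus (approx (S d) n) (approx d n)) <= D * (/ 2) ^ d).
  { induction d as [|d IH]; intros n.
    - apply Rle_trans with (1 := Cmod_le_Rabs _).
      destruct (HB 1%nat n) as [H1 H2].
      change (fst (Cminus (approx 1%nat n) (approx O n))) with (fst (approx 1%nat n) - x1 n).
      change (snd (Cminus (approx 1%nat n) (approx O n))) with (snd (approx 1%nat n) - y1 n).
      rewrite !Rabs_right by lra. specialize (HD n). simpl pow. lra.
    - generalize (Hcontr n _ _ (HB (S d) (S n)) (HB d (S n))) (IH (S n)).
      change (L n (approx (S d) (S n))) with (approx (S (S d)) n).
      change (L n (approx d (S n))) with (approx (S d) n). simpl pow. lra. }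
  assert (Hlim : forall n, exists l, forall d, Cmod (Cminus l (approx d n)) <= 4 * D * (/ 2) ^ d).
  { intros n. now apply dyadic_limit_C. }
  apply functional_choice in Hlim. destruct Hlim as (zeta & Hz).
  assert (HzB : forall n, B n (zeta n)).
  { intros n.
    assert (Hr : forall d, Rabs (fst (zeta n) - fst (approx d n)) <= 4 * D * (/ 2) ^ d).
    { intros d. apply Rle_trans with (2 := Hz n d). apply (Rabs_Re_le_Cmod (Cminus (zeta n) (approx d n))). }
    assert (Hi : forall d, Rabs (snd (zeta n) - snd (approx d n)) <= 4 * D * (/ 2) ^ d).
    { intros d. apply Rle_trans with (2 := Hz n d). apply (Rabs_Im_le_Cmod (Cminus (zeta n) (approx d n))). }
    split; split; apply Rminus_le; apply le_dyadic_le_0 with (4 * D); intros d;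
      destruct (HB d n); generalize (Hr d) (Hi d); intros Hrd Hid;
      apply Rabs_le_between' in Hrd, Hid; lra. }
  exists zeta. intros n. split; trivial.
  assert (HzL : zeta n = L n (zeta (S n))).
  { apply Ceq_minus. apply Cmod_eq_0. apply Rle_antisym; [|apply Cmod_ge_0].
    apply le_dyadic_le_0 with (4 * D). intros d.
    replace (Cminus (zeta n) (L n (zeta (S n)))) with
      (Cplus (Cminus (zeta n) (approx (S d) n)) (Cminus (approx (S d) n) (L n (zeta (S n))))) by ring.
    apply Rle_trans with (1 := Cmod_triangle _ _).
    generalize (Hz n (S d)) (Hz (S n) d).
    generalize (Hcontr n _ _ (HB d (S n)) (HzB (S n))).
    rewrite (Cmod_Cminus_sym (approx d (S n))).
    change (L n (approx d (S n))) with (approx (S d) n). simpl pow. lra. }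
  rewrite HzL at 1. now apply HL.
Qed.

(** * Explicit logarithms, and the boxes at one level *)

Lemma polar_form (w : C) : w <> 0%C ->
  exists t, 0 <= t <= 2 * PI /\ (0 <= snd w -> t <= PI) /\
    w = (Cmod w * cos t, Cmod w * sin t).
Proof.
  intros Hw. assert (Hm : 0 < Cmod w) by now apply Cmod_gt_0.
  set (r := Cmod w) in *.
  assert (Hsq : fst w ^ 2 + snd w ^ 2 = r ^ 2) by (unfold r; now rewrite Cmod_sqr).
  assert (Hre : fst w = r * (fst w / r)) by (field; lra).
  set (c := fst w / r) in *.
  assert (Hc : -1 <= c <= 1).
  { generalize (Rabs_Re_le_Cmod w); fold r; intros H. rewrite Hre in H.
    rewrite Rabs_mult, (Rabs_right r) in H by lra.
    assert (Rabs c <= 1) by (apply Rmult_le_reg_l with r; lra).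
    apply Rabs_le_between in H0. lra. }
  generalize (acos_bound c) (cos_acos c Hc) (sin_acos c Hc); intros Hb Hcos Hsin.
  assert (Hs : r * sin (acos c) = Rabs (snd w)).
  { rewrite Hsin. assert (H : 0 <= 1 - c²) by (unfold Rsqr; nra).
    apply Rsqr_inj; [apply Rmult_le_pos; [lra|apply sqrt_pos]|apply Rabs_pos|].
    rewrite <- Rsqr_abs, Rsqr_mult, Rsqr_sqrt by trivial. unfold Rsqr. rewrite Hre in Hsq. nra. }
  destruct (Rle_lt_dec 0 (snd w)) as [h|h].
  - exists (acos c). split; [lra|]. split; [lra|].
    rewrite Hcos, Hs, <- Hre, Rabs_right by lra. now destruct w.
  - exists (2 * PI - acos c). split; [lra|]. split; [lra|].
    replace (2 * PI - acos c) with (- acos c + 2 * INR 1 * PI) by (simpl; ring).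
    rewrite cos_period, sin_period, cos_neg, sin_neg, Hcos, <- Hre.
    replace (r * - sin (acos c)) with (- (r * sin (acos c))) by ring.
    rewrite Hs, Rabs_left by lra. destruct w; simpl; f_equal; ring.
Qed.

(** E_lam maps the line Im z = beta onto the positive real axis. The freedom in Y lets the boxes
    start at a prescribed height. *)
Lemma positive_rotation (lam : C) (Y : R) : lam <> 0%C -> 0 <= Y ->
  exists beta, Y <= beta <= Y + 2 * PI /\
    Cmult lam (cos beta, sin beta) = RtoC (Cmod lam).
Proof.
  intros Hl HY. destruct (polar_form lam Hl) as (t & Ht & _ & Heq).
  generalize PI_RGT_0; intros HPI.
  destruct (nfloor_ex ((Y + t) / (2 * PI))) as (k & Hk1 & Hk2).
  { apply Rmult_le_pos; [lra|]. left. apply Rinv_0_lt_compat. lra. }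
  assert (Hk : (Y + t) = (Y + t) / (2 * PI) * (2 * PI)) by (field; lra).
  exists (- t + 2 * INR (S k) * PI). split.
  - rewrite S_INR. set (u := (Y + t) / (2 * PI)) in *. nra.
  - rewrite cos_period, sin_period, cos_neg, sin_neg. rewrite Heq at 1.
    generalize (sin2_cos2 t); unfold Rsqr; intros H.
    unfold Cmult, RtoC; simpl. f_equal; [|ring].
    replace (Cmod lam * cos t * cos t - Cmod lam * sin t * - sin t)
      with (Cmod lam * (sin t * sin t + cos t * cos t)) by ring.
    rewrite H; ring.
Qed.

Lemma E_polar (lam w : C) (beta t : R) (k : nat) :
  lam <> 0%C -> w <> 0%C ->
  Cmult lam (cos beta, sin beta) = RtoC (Cmod lam) ->
  w = (Cmod w * cos t, Cmod w * sin t) ->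
  E lam (ln (Cmod w / Cmod lam), t + beta + 2 * INR k * PI) = w.
Proof.
  intros Hl Hw Hb Ht.
  assert (Hl' : 0 < Cmod lam) by now apply Cmod_gt_0.
  assert (Hw' : 0 < Cmod w) by now apply Cmod_gt_0.
  unfold E, Cexp; simpl fst; simpl snd.
  rewrite cos_period, sin_period, cos_plus, sin_plus, exp_ln by now apply Rdiv_lt_0_compat.
  set (e := Cmod w / Cmod lam).
  replace (e * (cos t * cos beta - sin t * sin beta), e * (sin t * cos beta + cos t * sin beta))
    with (Cmult (cos beta, sin beta) (e * cos t, e * sin t)) by (unfold Cmult; simpl; f_equal; ring).
  rewrite Cmult_assoc, Hb. rewrite Ht at 1. unfold Cmult, RtoC, e; simpl. f_equal; field; lra.
Qed.

Lemma ln_between (x y z : R) : 0 < x -> x <= y <= z -> ln x <= ln y <= ln z.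
Proof. intros H1 H2. split; apply ln_le; lra. Qed.

(* Logarithms are chosen with imaginary part in [2 PI, 6 PI], so that no preimage comes near 0. *)
Lemma Eiter_pullback (lam : nat -> C) (n : nat) (r1 r2 : R) :
  (forall n, (1 <= n)%nat -> lam n <> 0%C) -> 0 < r1 ->
  exists M, forall w, r1 <= Cmod w <= r2 ->
    exists z, Eiter lam n z = w /\ forall j, (j <= n)%nat -> Cmod (Eiter lam j z) <= M.
Proof.
  intros Hlam. revert r1 r2. induction n as [|n IH]; intros r1 r2 Hr.
  - exists r2. intros w Hw. exists w. split; trivial. intros j Hj.
    replace j with O by lia. simpl. lra.
  - generalize PI_RGT_0; intros HPI.
    assert (Hl : lam (S n) <> 0%C) by (apply Hlam; lia).
    assert (Hl' : 0 < Cmod (lam (S n))) by now apply Cmod_gt_0.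
    (* [b] bounds the chosen logarithm uniformly over the given annulus, so the induction hypothesis
       applies on an annulus with inner radius PI. *)
    set (b := Rabs (ln (r1 / Cmod (lam (S n)))) + Rabs (ln (r2 / Cmod (lam (S n)))) + 6 * PI).
    destruct (IH PI b HPI) as (M & HM).
    exists (Rmax M r2). intros w Hw.
    assert (Hw0 : w <> 0%C) by (intros ->; rewrite Cmod_0 in Hw; lra).
    destruct (polar_form w Hw0) as (t & Ht & _ & Hwt).
    destruct (positive_rotation (lam (S n)) 0 Hl) as (be & Hbe & Hrot); [lra|].
    generalize (E_polar _ _ _ _ 1 Hl Hw0 Hrot Hwt).
    set (u := (ln (Cmod w / Cmod (lam (S n))), t + be + 2 * INR 1 * PI)). intros Hu.
    destruct (HM u) as (z & Hz1 & Hz2).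
    { split.
      - apply Rle_trans with (2 := Rabs_Im_le_Cmod u). apply Rle_trans with (2 := Rle_abs _). simpl. lra.
      - apply Rle_trans with (1 := Cmod_le_Rabs u). unfold u, b; simpl fst; simpl snd.
        assert (Hln : ln (r1 / Cmod (lam (S n))) <= ln (Cmod w / Cmod (lam (S n))) <= ln (r2 / Cmod (lam (S n)))).
        { assert (0 < / Cmod (lam (S n))) by now apply Rinv_0_lt_compat.
          apply ln_between; [now apply Rdiv_lt_0_compat|].
          split; apply Rmult_le_compat_r; lra. }
        assert (Hab : Rabs (ln (Cmod w / Cmod (lam (S n)))) <=
          Rabs (ln (r1 / Cmod (lam (S n)))) + Rabs (ln (r2 / Cmod (lam (S n))))).
        { apply Rabs_le.
          generalize (Rabs_pos (ln (r1 / Cmod (lam (S n))))) (Rabs_pos (ln (r2 / Cmod (lam (S n))))).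
          generalize (Rle_abs (- ln (r1 / Cmod (lam (S n))))) (Rle_abs (ln (r2 / Cmod (lam (S n))))).
          rewrite Rabs_Ropp. lra. }
        rewrite (Rabs_right (t + be + 2 * 1 * PI)) by lra. lra. }
    exists z. assert (Hzw : Eiter lam (S n) z = w) by (simpl; now rewrite Hz1).
    split; trivial. intros j Hj. destruct (Nat.eq_dec j (S n)) as [->|Hn].
    + rewrite Hzw. apply Rle_trans with r2; [lra|apply Rmax_r].
    + apply Rle_trans with M; [apply Hz2; lia|apply Rmax_l].
Qed.

(** The strip passes through the annulus over a height of order D rho. Boxes are stacked there, each
    starting on a line that E_lam maps to the positive axis and having height PI, so that it maps
    into the closed upper half plane. *)
Lemma level_boxes (q D rho alpha : R) (lam : C) :
  0 < q < 1 -> 0 < D <= 1 -> 512 <= D * rho -> 3 * D <= 2 * (1 - q) * rho ->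
  Rabs alpha <= q * rho + D -> lam <> 0%C ->
  exists p : R * nat,
    (2 <= snd p)%nat /\ D / 256 * rho <= INR (snd p) <= rho /\ 0 < fst p /\
    Cmult lam (cos (fst p), sin (fst p)) = RtoC (Cmod lam) /\
    forall (k : nat) (x y : R), (k < snd p)%nat ->
      alpha <= x <= alpha + D -> fst p + 4 * PI * INR k <= y <= fst p + 4 * PI * INR k + PI ->
      rho ^ 2 <= x ^ 2 + y ^ 2 <= (rho * exp D) ^ 2.
Proof.
  intros Hq HD H512 H3 Hal Hl.
  generalize PI_RGT_0 PI_4; intros HPI HPI4.
  assert (Hrho : 512 <= rho) by nra.
  assert (Hal1 : Rabs alpha <= rho) by nra.
  generalize (Rabs_pos alpha); intros Hal0.
  assert (Hal2 : alpha ^ 2 <= rho ^ 2) by (rewrite <- (pow2_abs alpha); nra).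
  (* The point alpha + iY has squared modulus rho^2 (1 + D / 2), which leaves room inside for the
     variation of x^2 across the strip and outside also for the stack of boxes. *)
  set (Y := sqrt (rho ^ 2 * (1 + D / 2) - alpha ^ 2)).
  assert (Harg : 0 < rho ^ 2 * (1 + D / 2) - alpha ^ 2) by nra.
  assert (HY2 : Y ^ 2 = rho ^ 2 * (1 + D / 2) - alpha ^ 2) by (unfold Y; apply pow2_sqrt; lra).
  assert (HY0 : 0 < Y) by now apply sqrt_lt_R0.
  assert (HY1 : Y <= 5 / 4 * rho) by (generalize (pow2_ge_0 alpha); nra).
  destruct (positive_rotation lam Y Hl) as (be & Hbe & Hrot); [lra|].
  (* With the offset of [be] by up to 2 PI the stack has height at most 4 PI N <= 16 N <= D rho / 8.
     Since D rho >= 512, rounding down still leaves N >= D rho / 256. *)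
  destruct (nfloor_ex (D * rho / 128 - 1)) as (N & HN1 & HN2); [lra|].
  exists (be, N). cbn [fst snd].
  assert (HN2' : 2 <= INR N) by lra.
  split; [apply INR_le; simpl; lra|]. split; [split; nra|]. split; [lra|]. split; [trivial|].
  intros k x y Hk Hx Hy.
  assert (HkN : INR k + 1 <= INR N) by (rewrite <- S_INR; apply le_INR; lia).
  generalize (pos_INR k); intros Hk0.
  assert (Hk4 : 0 <= PI * INR k) by (apply Rmult_le_pos; lra).
  assert (Hy1 : Y <= y) by lra.
  assert (HPIk : PI * (INR k + 1) <= 4 * INR N) by (apply Rmult_le_compat; lra).
  assert (Hy2 : y <= Y + D * rho / 8) by lra.
  (* The condition 3 D <= 2 (1 - q) rho gives 2 |alpha| + D <= 2 q rho + 3 D <= 2 rho. *)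
  assert (Hxa : Rabs (x ^ 2 - alpha ^ 2) <= 2 * D * rho).
  { replace (x ^ 2 - alpha ^ 2) with ((x - alpha) * (x + alpha)) by ring.
    rewrite Rabs_mult. rewrite (Rabs_right (x - alpha)) by lra.
    assert (Rabs (x + alpha) <= 2 * Rabs alpha + D).
    { replace (x + alpha) with (2 * alpha + (x - alpha)) by ring.
      apply Rle_trans with (1 := Rabs_triang _ _). rewrite Rabs_mult, (Rabs_right 2), (Rabs_right (x - alpha)) by lra. lra. }
    apply Rle_trans with (D * (2 * rho)); [|lra].
    apply Rmult_le_compat; [lra|apply Rabs_pos|lra|lra]. }
  apply Rabs_le_between in Hxa.
  assert (HDr : D * rho * 512 <= D * rho * rho) by (apply Rmult_le_compat_l; [nra|lra]).
  assert (Hsq1 : Y ^ 2 <= y ^ 2) by (apply pow_incr; lra).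
  assert (Hsq2 : y ^ 2 <= Y ^ 2 + D * rho ^ 2 * (3 / 8)).
  { apply Rle_trans with ((Y + D * rho / 8) ^ 2); [apply pow_incr; lra|].
    assert (Y * (D * rho) <= 5 / 4 * rho * (D * rho)) by (apply Rmult_le_compat_r; [nra|lra]).
    assert (D * rho * (D * rho) <= D * rho * rho) by (apply Rmult_le_compat_l; nra).
    nra. }
  split; [nra|].
  apply Rle_trans with (rho ^ 2 * (1 + D) ^ 2).
  - nra.
  - rewrite Rpow_mult_distr. apply Rmult_le_compat_l; [apply pow2_ge_0|].
    apply pow_incr. generalize (exp_ineq1_le D); lra.
Qed.

(** * The lower bound *)

Lemma exp_le (x y : R) : x <= y -> exp x <= exp y.
Proof. intros [h| ->]; [left; now apply exp_increasing|lra]. Qed.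

Lemma eventually_bounded_below (u : nat -> R) (g0 : R) (N : nat) :
  0 < g0 -> (forall m, 0 < u m) -> (forall m, (N <= m)%nat -> g0 <= u m) ->
  exists g, 0 < g /\ forall m, g <= u m.
Proof.
  intros Hg0 Hu. induction N as [|N IH]; intros H.
  - exists g0. split; trivial. intros m; apply H; lia.
  - destruct (Rle_lt_dec g0 (u N)) as [h|h].
    + apply IH. intros m Hm. destruct (Nat.eq_dec m N) as [->|]; [trivial|apply H; lia].
    + revert IH. generalize (Hu N). set (g := u N) in *. intros Hg _.
      assert (K : forall k, exists g, 0 < g /\ g <= g0 /\ forall m, (m < k)%nat -> g <= u m).
      { induction k as [|k (g' & H1 & H2 & H3)]; [exists g0; repeat split; [trivial|lra|lia]|].
        exists (Rmin g' (u k)). split; [now apply Rmin_pos|].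
        split; [apply Rle_trans with (1 := Rmin_l _ _); trivial|].
        intros m Hm. destruct (Nat.eq_dec m k) as [->|]; [apply Rmin_r|].
        apply Rle_trans with (1 := Rmin_l _ _). apply H3; lia. }
      destruct (K (S N)) as (g' & H1 & H2 & H3). exists g'. split; trivial.
      intros m. destruct (Nat.lt_ge_cases m (S N)) as [hm|hm]; [now apply H3|].
      specialize (H m hm). lra.
Qed.

Section LowerBound.

Variables (lam : nat -> C) (a b : nat -> R) (q D : R) (n0 : nat).
Hypothesis Hlam : forall n, (1 <= n)%nat -> lam n <> 0%C.
Hypothesis Ha_pos : forall n, (1 <= n)%nat -> 0 < a n.
Hypothesis Hq : 0 < q < 1.
Hypothesis HD : 0 < D <= 1.
Hypothesis Hn0 : (1 <= n0)%nat.
Hypothesis Hstep : forall n, (n0 <= n)%nat ->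
  a (S n) <= Cmod (lam (S n)) * exp (q * a n) /\
  Cmod (lam (S n)) * exp (- (q * a n)) <= b (S n).
Hypothesis Hab : forall n, (n0 <= n)%nat -> a n * exp D <= b n.
Hypothesis Hbig : forall n, (n0 <= n)%nat -> 512 <= D * a n /\ 3 * D <= 2 * (1 - q) * a n.
Hypothesis Hgrow : forall K, 0 < K -> exists N, forall n, (N <= n)%nat -> K ^ n <= prod1 a n.

(* The strip alpha <= Re z <= alpha + D lies in the preimage of the n-th annulus and
   within distance q a + 2 D of the imaginary axis, by hypothesis (a). *)
Definition strip_left (m : nat) : R :=
  Rmax (ln (a (S (n0 + m)) / Cmod (lam (S (n0 + m))))) (- (q * a (n0 + m)%nat) - D).

(** At a successor level this is the modulus of the image of the strip's left edge, so strip m, at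
    time n0 + m, maps onto the annulus between [inner_radius (S m)] and e^D times it. *)
Definition inner_radius (m : nat) : R :=
  match m with
  | O => a n0
  | S m => Cmod (lam (S (n0 + m))) * exp (strip_left m)
  end.

Lemma lam_pos (m : nat) : 0 < Cmod (lam (S (n0 + m))).
Proof. apply Cmod_gt_0, Hlam. lia. Qed.

Lemma inner_radius_ge (m : nat) : a (n0 + m)%nat <= inner_radius m.
Proof.
  destruct m as [|m]; [rewrite Nat.add_0_r; simpl; lra|].
  replace (n0 + S m)%nat with (S (n0 + m)) by lia. simpl.
  generalize (lam_pos m); intros Hl.
  assert (Ha : 0 < a (S (n0 + m))) by (apply Ha_pos; lia).
  apply Rle_trans with (Cmod (lam (S (n0 + m))) * exp (ln (a (S (n0 + m)) / Cmod (lam (S (n0 + m)))))).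
  - rewrite exp_ln by (now apply Rdiv_lt_0_compat). right; field; lra.
  - apply Rmult_le_compat_l; [lra|]. apply exp_le, Rmax_l.
Qed.

Lemma inner_radius_pos (m : nat) : 0 < inner_radius m.
Proof.
  apply Rlt_le_trans with (2 := inner_radius_ge m). apply Ha_pos. lia.
Qed.

(** If the maximum in [strip_left] is the logarithm, the inner radius is a itself and the width
    condition applies. Otherwise the right edge is -q a, because of the shift by -D, and the second
    half of (a) applies. *)
Lemma outer_radius_le (m : nat) : inner_radius m * exp D <= b (n0 + m)%nat.
Proof.
  destruct m as [|m]; [rewrite Nat.add_0_r; simpl; now apply Hab|].
  replace (n0 + S m)%nat with (S (n0 + m)) by lia. simpl.
  generalize (lam_pos m); intros Hl.
  assert (Ha : 0 < a (S (n0 + m))) by (apply Ha_pos; lia).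
  unfold strip_left. apply Rmax_case.
  - rewrite exp_ln by (now apply Rdiv_lt_0_compat).
    replace (Cmod (lam (S (n0 + m))) * (a (S (n0 + m)) / Cmod (lam (S (n0 + m))))) with (a (S (n0 + m))) by (field; lra).
    apply Hab; lia.
  - rewrite Rmult_assoc, <- exp_plus. replace (- (q * a (n0 + m)%nat) - D + D) with (- (q * a (n0 + m)%nat)) by ring.
    apply Hstep; lia.
Qed.

Lemma strip_left_bound (m : nat) : Rabs (strip_left m) <= q * inner_radius m + D.
Proof.
  generalize (inner_radius_ge m) (lam_pos m); intros Hr Hl.
  assert (Ha : 0 < a (S (n0 + m))) by (apply Ha_pos; lia).
  assert (Ha' : 0 < a (n0 + m)%nat) by (apply Ha_pos; lia).
  assert (Hqa : q * a (n0 + m)%nat <= q * inner_radius m) by (apply Rmult_le_compat_l; lra).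
  assert (0 < q * a (n0 + m)%nat) by nra.
  apply Rabs_le. split.
  - apply Rle_trans with (2 := Rmax_r _ _). lra.
  - apply Rmax_lub; [|lra].
    apply Rle_trans with (q * a (n0 + m)%nat); [|lra].
    rewrite <- (ln_exp (q * a (n0 + m)%nat)). apply ln_le; [now apply Rdiv_lt_0_compat|].
    apply Rmult_le_reg_l with (Cmod (lam (S (n0 + m)))); trivial.
    replace (Cmod (lam (S (n0 + m))) * (a (S (n0 + m)) / Cmod (lam (S (n0 + m))))) with (a (S (n0 + m))) by (field; lra).
    apply Hstep; lia.
Qed.

Lemma inner_radius_big (m : nat) :
  512 <= D * inner_radius m /\ 3 * D <= 2 * (1 - q) * inner_radius m.
Proof.
  generalize (inner_radius_ge m); intros Hr. destruct (Hbig (n0 + m)%nat) as [H1 H2]; [lia|].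
  split; [nra|]. apply Rle_trans with (1 := H2). apply Rmult_le_compat_l; lra.
Qed.

Variables (beta : nat -> R) (N : nat -> nat).
Hypothesis HN2 : forall m, (2 <= N m)%nat.
Hypothesis HNr : forall m, D / 256 * inner_radius m <= INR (N m) <= inner_radius m.
Hypothesis Hbeta : forall m, 0 < beta m.
Hypothesis Hrot : forall m,
  Cmult (lam (S (n0 + m))) (cos (beta m), sin (beta m)) = RtoC (Cmod (lam (S (n0 + m)))).
Hypothesis Hbox : forall m (k : nat) (x y : R), (k < N m)%nat ->
  strip_left m <= x <= strip_left m + D ->
  beta m + 4 * PI * INR k <= y <= beta m + 4 * PI * INR k + PI ->
  inner_radius m ^ 2 <= x ^ 2 + y ^ 2 <= (inner_radius m * exp D) ^ 2.

Definition in_box (m k : nat) (z : C) : Prop :=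
  strip_left m <= fst z <= strip_left m + D /\
  beta m + 4 * PI * INR k <= snd z <= beta m + 4 * PI * INR k + PI.

Lemma in_box_annulus (m k : nat) (z : C) : (k < N m)%nat -> in_box m k z ->
  inner_radius m <= Cmod z <= inner_radius m * exp D.
Proof.
  intros Hk [H1 H2]. destruct (Hbox m k _ _ Hk H1 H2) as [H3 H4].
  generalize (inner_radius_pos m) (exp_pos D); intros.
  split; [apply Cmod_ge_sqr|apply Cmod_le_sqr]; trivial; [lra|].
  apply Rmult_le_pos; lra.
Qed.

(** Boxes lie in the upper half plane, so w has an argument t in [0, PI]; adding beta and 4 PI k to
    it lands in box k of the previous level, whichever box w is in. *)
Lemma in_box_pullback (m k k' : nat) (w : C) : (k' < N (S m))%nat -> in_box (S m) k' w ->
  exists u, in_box m k u /\ E (lam (S (n0 + m))) u = w.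
Proof.
  intros Hk' Hw. generalize PI_RGT_0; intros HPI.
  generalize (in_box_annulus _ _ _ Hk' Hw) (inner_radius_pos (S m)) (lam_pos m); intros Hann Hr Hl.
  assert (Hw0 : w <> 0%C) by (intros ->; rewrite Cmod_0 in Hann; lra).
  destruct (polar_form w Hw0) as (t & Ht0 & Ht1 & Hwt).
  assert (HtPI : t <= PI).
  { apply Ht1. destruct Hw as [_ [Hy _]].
    assert (0 <= 4 * PI * INR k') by (apply Rmult_le_pos; [lra|apply pos_INR]).
    generalize (Hbeta (S m)); lra. }
  assert (Hl0 : lam (S (n0 + m)) <> 0%C) by (apply Hlam; lia).
  exists (ln (Cmod w / Cmod (lam (S (n0 + m)))), t + beta m + 2 * INR (2 * k) * PI).
  split; [|now apply E_polar].
  split; cbn [fst snd].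
  - simpl inner_radius in Hann. set (c := Cmod (lam (S (n0 + m)))) in *.
    rewrite <- (ln_exp (strip_left m)) at 1. rewrite <- (ln_exp (strip_left m + D)).
    rewrite Rmult_assoc, <- exp_plus in Hann.
    apply ln_between; [apply exp_pos|].
    split; apply Rmult_le_reg_l with c; trivial;
      replace (c * (Cmod w / c)) with (Cmod w) by (field; lra); lra.
  - rewrite mult_INR. simpl (INR 2). lra.
Qed.

Lemma realise_itinerary (kappa : nat -> nat) :
  (forall m, (kappa m < N m)%nat) ->
  exists zeta : nat -> C, forall m, in_box m (kappa m) (zeta m) /\
    E (lam (S (n0 + m))) (zeta m) = zeta (S m).
Proof.
  intros Hk. generalize PI_RGT_0; intros HPI.
  apply (backward_contraction_orbit (fun m => E (lam (S (n0 + m))))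
    strip_left (fun m => strip_left m + D)
    (fun m => beta m + 4 * PI * INR (kappa m)) (fun m => beta m + 4 * PI * INR (kappa m) + PI) (D + PI)).
  - intros m; lra.
  - intros m; lra.
  - intros m; lra.
  - intros m w Hw. now apply (in_box_pullback m (kappa m) (kappa (S m))).
  - intros m u v Hu Hv HEu HEv.
    apply (in_box_annulus (S m) (kappa (S m))) in HEu; trivial.
    apply (in_box_annulus (S m) (kappa (S m))) in HEv; trivial.
    assert (Hr : 512 <= inner_radius (S m)).
    { destruct (inner_radius_big (S m)). generalize (inner_radius_pos (S m)). nra. }
    assert (H : inner_radius (S m) * Cmod (Cminus u v) <=
       3 * Cmod (Cminus (E (lam (S (n0 + m))) u) (E (lam (S (n0 + m))) v))).
    { apply E_expanding; [lra|apply HEu|apply HEv|]. apply Rabs_le. lra. }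
    generalize (Cmod_ge_0 (Cminus u v)); intros. nra.
Qed.

Variable M : R.
Hypothesis HM : forall w, inner_radius 0 <= Cmod w <= inner_radius 0 * exp D ->
  exists z, Eiter lam n0 z = w /\ forall j, (j <= n0)%nat -> Cmod (Eiter lam j z) <= M.

(** Given as a relation, with no preferred z for each x. The bound M on the first n0 steps yields a
    Lipschitz constant common to all coded points. *)
Definition coded_by (x : R) (z : C) : Prop :=
  (forall j, (j <= n0)%nat -> Cmod (Eiter lam j z) <= M) /\
  (forall m, in_box m (radix_digit N x m) (Eiter lam (n0 + m) z)).

Lemma digit_lt (x : R) (m : nat) : 0 <= x < 1 -> (radix_digit N x m < N m)%nat.
Proof. intros Hx. apply radix_digit_lt; trivial. generalize (HN2 m); lia. Qed.

Lemma coded_exists (x : R) : 0 <= x < 1 -> exists z, coded_by x z.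
Proof.
  intros Hx. destruct (realise_itinerary (radix_digit N x)) as (zeta & Hz).
  { intros m. now apply digit_lt. }
  destruct (HM (zeta O)) as (z & Hz0 & HzM).
  { apply in_box_annulus with (radix_digit N x 0); [now apply digit_lt|apply Hz]. }
  exists z. split; trivial.
  assert (Heq : forall m, Eiter lam (n0 + m) z = zeta m).
  { induction m as [|m IH]; [now rewrite Nat.add_0_r|].
    rewrite Nat.add_succ_r. simpl. rewrite IH. apply Hz. }
  intros m. rewrite Heq. apply Hz.
Qed.

Lemma coded_in_Iab (x : R) (z : C) : 0 <= x < 1 -> coded_by x z -> Iab lam a b z.
Proof.
  intros Hx [_ Hz]. exists n0. intros n Hn. replace n with (n0 + (n - n0))%nat by lia.
  set (m := (n - n0)%nat).
  generalize (in_box_annulus m _ _ (digit_lt x m Hx) (Hz m)) (inner_radius_ge m) (outer_radius_le m); lra.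
Qed.

(** As |E'| = |E|, this is up to a factor 3^m the derivative of the composition from level 0 to
    level m; hence it starts with the radius at level 1. *)
Fixpoint radius_prod (m : nat) : R :=
  match m with O => 1 | S m => radius_prod m * inner_radius (S m) end.

Lemma radius_prod_pos (m : nat) : 0 < radius_prod m.
Proof.
  induction m; cbn [radius_prod]; [lra|]. apply Rmult_lt_0_compat; [trivial|apply inner_radius_pos].
Qed.

Lemma exp_D_le_3 : exp D <= 3.
Proof. apply Rle_trans with (exp 1); [apply exp_le; lra|apply exp_le_3]. Qed.

Lemma orbit_lipschitz (x y : R) (z w : C) (m : nat) :
  0 <= x < 1 -> 0 <= y < 1 -> coded_by x z -> coded_by y w ->
  Cmod (Cminus (Eiter lam (n0 + m) z) (Eiter lam (n0 + m) w)) <=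
  (Rmax M 1) ^ n0 * 3 ^ m * radius_prod m * Cmod (Cminus z w).
Proof.
  intros Hx Hy [Hz1 Hz2] [Hw1 Hw2].
  generalize (Cmod_ge_0 (Cminus z w)) (Rmax_r M 1); intros Hd HM1.
  assert (H0 : forall j, (j <= n0)%nat ->
    Cmod (Cminus (Eiter lam j z) (Eiter lam j w)) <= (Rmax M 1) ^ j * Cmod (Cminus z w)).
  { induction j as [|j IH]; intros Hj; [simpl; lra|].
    apply Rle_trans with (Rmax M 1 * Cmod (Cminus (Eiter lam j z) (Eiter lam j w))).
    - apply (E_lipschitz (lam (S j)));
        apply Rle_trans with (2 := Rmax_l M 1); [apply (Hz1 (S j) Hj)|apply (Hw1 (S j) Hj)].
    - simpl pow. rewrite Rmult_assoc. apply Rmult_le_compat_l; [lra|apply IH; lia]. }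
  induction m as [|m IH].
  - rewrite Nat.add_0_r. simpl. generalize (H0 n0 (le_n n0)); lra.
  - generalize (in_box_annulus _ _ _ (digit_lt x (S m) Hx) (Hz2 (S m)))
               (in_box_annulus _ _ _ (digit_lt y (S m) Hy) (Hw2 (S m))).
    rewrite Nat.add_succ_r. intros [_ Hzb] [_ Hwb].
    apply Rle_trans with (inner_radius (S m) * exp D *
      Cmod (Cminus (Eiter lam (n0 + m) z) (Eiter lam (n0 + m) w))).
    { now apply (E_lipschitz (lam (S (n0 + m)))). }
    generalize (inner_radius_pos (S m)) exp_D_le_3 (exp_pos D); intros Hr He He0.
    apply Rle_trans with (inner_radius (S m) * 3 *
      ((Rmax M 1) ^ n0 * 3 ^ m * radius_prod m * Cmod (Cminus z w))).
    + apply Rmult_le_compat; [nra|apply Cmod_ge_0| |apply IH]. nra.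
    + right. cbn [radius_prod pow]. ring.
Qed.

(** At the first differing level, digits k apart give boxes at least 4 PI k - PI >= k apart in
    height. The bound on k by the last radius is what later allows that radius to be divided out. *)
Lemma coded_separation (x y : R) (z w : C) :
  0 <= x < 1 -> 0 <= y < 1 -> x <> y -> coded_by x z -> coded_by y w ->
  exists (m : nat) (k : R), 1 <= k <= inner_radius m /\
    k <= (Rmax M 1) ^ n0 * 3 ^ m * radius_prod m * Cmod (Cminus z w) /\
    radix_prod N (S m) * Rabs (x - y) <= 2 * k.
Proof.
  intros Hx Hy Hxy Hz Hw. generalize PI2_1; intros HPI.
  destruct (radix_separation N x y HN2 Hx Hy Hxy) as (m & Hm & Hmxy).
  set (k := Rabs (INR (radix_digit N x m) - INR (radix_digit N y m))) in *.
  assert (Hk1 : 1 <= k).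
  { unfold k. destruct (Nat.lt_gt_cases (radix_digit N x m) (radix_digit N y m)) as [Hc _].
    destruct (Hc Hm) as [h|h]; apply le_INR in h; rewrite S_INR in h.
    - rewrite Rabs_left1; lra.
    - rewrite Rabs_right; lra. }
  exists m, k. split; [split; trivial|split; [|lra]].
  - generalize (HNr m) (digit_lt x m Hx) (digit_lt y m Hy); intros HN Hdx Hdy.
    apply lt_INR in Hdx, Hdy. apply Rle_trans with (INR (N m)); [|lra].
    generalize (pos_INR (radix_digit N x m)) (pos_INR (radix_digit N y m)); intros.
    apply Rabs_le. lra.
  - apply Rle_trans with (2 := orbit_lipschitz x y z w m Hx Hy Hz Hw).
    apply Rle_trans with (2 := Rabs_Im_le_Cmod _).
    destruct (proj2 Hz m) as [_ Hz']. destruct (proj2 Hw m) as [_ Hw'].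
    change (snd (Cminus (Eiter lam (n0 + m) z) (Eiter lam (n0 + m) w)))
      with (snd (Eiter lam (n0 + m) z) - snd (Eiter lam (n0 + m) w)).
    set (X := snd (Eiter lam (n0 + m) z)) in *. set (Y := snd (Eiter lam (n0 + m) w)) in *.
    unfold k in *. set (i := INR (radix_digit N x m)) in *. set (j := INR (radix_digit N y m)) in *.
    clearbody i j X Y. unfold Rabs in Hk1 |- *.
    destruct (Rcase_abs (i - j)); destruct (Rcase_abs (X - Y)); nra.
Qed.

Lemma radix_prod_lower (m : nat) :
  (D / 256) ^ S m * (inner_radius 0 * radius_prod m) <= radix_prod N (S m).
Proof.
  induction m as [|m IH].
  - simpl. generalize (HNr 0). simpl. lra.
  - change (radix_prod N (S (S m))) with (radix_prod N (S m) * INR (N (S m))).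
    replace ((D / 256) ^ S (S m) * (inner_radius 0 * radius_prod (S m))) with
      ((D / 256) ^ S m * (inner_radius 0 * radius_prod m) * (D / 256 * inner_radius (S m)))
      by (cbn [radius_prod pow]; ring).
    generalize (inner_radius_pos 0) (inner_radius_pos (S m)) (radius_prod_pos m); intros.
    apply Rmult_le_compat; trivial; [| |apply HNr].
    + apply Rmult_le_pos; [apply pow_le; lra|nra].
    + apply Rmult_le_pos; lra.
Qed.

(** Without its last radius the product is the one up to m - 1, which still outgrows every
    exponential. *)
Lemma radius_prod_growth (K : R) : 0 < K ->
  exists g, 0 < g /\ forall m, g * K ^ m * inner_radius m <= radius_prod m.
Proof.
  intros HK.
  assert (Hp : forall m, prod1 a (n0 + m) <= prod1 a n0 * radius_prod m).
  { induction m as [|m IH]; [rewrite Nat.add_0_r; simpl; lra|].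
    generalize (inner_radius_ge (S m)). rewrite Nat.add_succ_r. cbn [prod1 radius_prod]. intros Hr.
    rewrite <- Rmult_assoc. apply Rmult_le_compat; trivial.
    - left; now apply prod1_pos.
    - left; apply Ha_pos; lia. }
  assert (H0 : 0 < prod1 a n0) by now apply prod1_pos.
  assert (HKm : forall m, 0 < K ^ m) by (intros; now apply pow_lt).
  set (u := fun m => radius_prod m / (K ^ m * inner_radius m)).
  destruct (Hgrow K HK) as (N1 & HN1).
  (* K^n0 / prod1 a n0 accounts for the first n0 factors, and 1 / K for the index shift when the
     last radius cancels. *)
  destruct (eventually_bounded_below u (K ^ n0 / (prod1 a n0 * K)) (S N1)) as (g & Hg & Hu).
  - apply Rdiv_lt_0_compat; [apply HKm|nra].
  - intros m. apply Rdiv_lt_0_compat; [apply radius_prod_pos|].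
    apply Rmult_lt_0_compat; [apply HKm|apply inner_radius_pos].
  - intros [|m] Hm; [lia|]. unfold u. cbn [radius_prod].
    generalize (inner_radius_pos (S m)) (HKm m) (HKm n0) (Hp m); intros Hr H1 H2 H3.
    assert (H4 : K ^ n0 * K ^ m <= prod1 a (n0 + m)) by (rewrite <- pow_add; apply HN1; lia).
    replace (radius_prod m * inner_radius (S m) / (K ^ S m * inner_radius (S m)))
      with (radius_prod m / (K * K ^ m)) by (simpl pow; field; lra).
    apply Rmult_le_reg_r with (prod1 a n0 * (K * K ^ m)); [repeat apply Rmult_lt_0_compat; trivial|].
    replace (K ^ n0 / (prod1 a n0 * K) * (prod1 a n0 * (K * K ^ m))) with (K ^ n0 * K ^ m) by (field; lra).
    replace (radius_prod m / (K * K ^ m) * (prod1 a n0 * (K * K ^ m))) with (prod1 a n0 * radius_prod m) by (field; lra).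
    lra.
  - exists g. split; trivial. intros m. specialize (Hu m). unfold u in Hu.
    generalize (inner_radius_pos m) (HKm m); intros Hr Hk.
    assert (Hkr : 0 < K ^ m * inner_radius m) by now apply Rmult_lt_0_compat.
    apply (Rmult_le_compat_r (K ^ m * inner_radius m)) in Hu; [|lra].
    replace (radius_prod m / (K ^ m * inner_radius m) * (K ^ m * inner_radius m)) with (radius_prod m) in Hu by (field; lra).
    lra.
Qed.

(** With X = k / [radius_prod m], |x - y| is at most a constant times c^(-m) X. In X = X^(1-s) X^s
    the first factor is bounded by growth and the second by the distance of the points. *)
Lemma coding_inverse_holder (s : R) : 0 < s < 1 ->
  exists Cs, 0 < Cs /\ forall x y z w,
    0 <= x < 1 -> 0 <= y < 1 -> x <> y -> coded_by x z -> coded_by y w ->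
    0 < Cmod (Cminus z w) /\ Rabs (x - y) <= Cs * Rpower (Cmod (Cminus z w)) s.
Proof.
  intros Hs.
  set (c := D / 256). assert (Hc : 0 < c) by (unfold c; lra).
  (* K^(1-s) = 3 / c, so the gain (c / 3)^m pays both for c^(-m), lost in the box counts, and for
     (3^m)^s <= 3^m, lost in the distortion. *)
  set (K := Rpower (3 / c) (/ (1 - s))).
  assert (H3c : 0 < 3 / c) by (apply Rdiv_lt_0_compat; lra).
  destruct (radius_prod_growth K) as (g & Hg & Hgm); [apply Rpower_pos|].
  set (K0 := Rmax M 1 ^ n0).
  assert (HK0 : 1 <= K0) by (apply pow_R1_Rle, Rmax_r).
  set (r0 := inner_radius 0). assert (Hr0 : 0 < r0) by apply inner_radius_pos.
  exists (2 / (c * r0) * Rpower (/ g) (1 - s) * Rpower K0 s).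
  assert (Hcr : 0 < 2 / (c * r0)) by (apply Rdiv_lt_0_compat; [lra|nra]).
  split.
  { apply Rmult_lt_0_compat; [|apply Rpower_pos]. apply Rmult_lt_0_compat; [trivial|apply Rpower_pos]. }
  intros x y z w Hx Hy Hxy Hz Hw.
  destruct (coded_separation x y z w Hx Hy Hxy Hz Hw) as (m & k & Hk & Hkd & Hxyk).
  fold K0 in Hkd. set (d := Cmod (Cminus z w)) in *.
  generalize (radius_prod_pos m) (inner_radius_pos m); intros Hp Hr.
  assert (H3m : 0 < 3 ^ m) by (apply pow_lt; lra).
  assert (Hd : 0 < d).
  { destruct (Cmod_ge_0 (Cminus z w)) as [h|h]; [trivial|]. fold d in h. rewrite <- h in Hkd. lra. }
  split; trivial.
  set (X := k / radius_prod m).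
  assert (HX : 0 < X) by (apply Rdiv_lt_0_compat; lra).
  assert (Hcm : 0 < c ^ m) by now apply pow_lt.
  assert (HKm : 0 < K ^ m) by (apply pow_lt, Rpower_pos).
  assert (H1 : Rabs (x - y) <= 2 / (c * r0) * / c ^ m * X).
  { generalize (radix_prod_lower m); fold c r0; intros Hrl.
    assert (Hpos : 0 < c ^ S m * (r0 * radius_prod m)).
    { apply Rmult_lt_0_compat; [now apply pow_lt|now apply Rmult_lt_0_compat]. }
    apply Rmult_le_reg_l with (c ^ S m * (r0 * radius_prod m)); trivial.
    replace (c ^ S m * (r0 * radius_prod m) * (2 / (c * r0) * / c ^ m * X)) with (2 * k)
      by (unfold X; simpl pow; field; repeat split; lra).
    apply Rle_trans with (2 := Hxyk). apply Rmult_le_compat_r; [apply Rabs_pos|trivial]. }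
  assert (H2 : X <= K0 * (3 ^ m * d)).
  { apply Rmult_le_reg_r with (radius_prod m); trivial.
    replace (X * radius_prod m) with k by (unfold X; field; lra). lra. }
  assert (H3 : X <= / g * / K ^ m).
  { specialize (Hgm m). apply Rmult_le_reg_r with (radius_prod m * (g * K ^ m)).
    { apply Rmult_lt_0_compat; [trivial|now apply Rmult_lt_0_compat]. }
    replace (X * (radius_prod m * (g * K ^ m))) with (k * (g * K ^ m)) by (unfold X; field; lra).
    replace (/ g * / K ^ m * (radius_prod m * (g * K ^ m))) with (radius_prod m) by (field; lra).
    assert (0 < g * K ^ m) by now apply Rmult_lt_0_compat. nra. }
  assert (H4 : Rpower X (1 - s) <= Rpower (/ g) (1 - s) * (c ^ m * / 3 ^ m)).
  { apply Rle_trans with (Rpower (/ g * / K ^ m) (1 - s)).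
    { apply Rle_Rpower_l; [lra|split; trivial]. }
    rewrite <- Rpower_mult_distr by now apply Rinv_0_lt_compat.
    right. f_equal. rewrite <- Rpower_pow by apply Rpower_pos.
    unfold K. rewrite Rpower_mult, <- Rpower_Ropp, Rpower_mult.
    replace (- (/ (1 - s) * INR m) * (1 - s)) with (- INR m) by (field; lra).
    rewrite Rpower_Ropp, Rpower_pow by trivial.
    unfold Rdiv. rewrite Rpow_mult_distr, pow_inv. field. lra. }
  assert (H5 : Rpower X s <= Rpower K0 s * (3 ^ m * Rpower d s)).
  { apply Rle_trans with (Rpower (K0 * (3 ^ m * d)) s).
    { apply Rle_Rpower_l; [lra|split; trivial]. }
    rewrite <- Rpower_mult_distr; [|lra|now apply Rmult_lt_0_compat].
    rewrite <- Rpower_mult_distr; [|trivial|trivial].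
    apply Rmult_le_compat_l; [left; apply Rpower_pos|].
    apply Rmult_le_compat_r; [left; apply Rpower_pos|].
    rewrite <- (Rpower_1 (3 ^ m)) at 2 by trivial.
    apply Rle_Rpower; [apply pow_R1_Rle; lra|lra]. }
  apply Rle_trans with (1 := H1).
  replace X with (Rpower X (1 - s) * Rpower X s).
  2:{ rewrite <- Rpower_plus. replace (1 - s + s) with 1 by ring. now apply Rpower_1. }
  generalize (Rpower_pos X (1 - s)) (Rpower_pos X s) (Rpower_pos (/ g) (1 - s)); intros P1 P2 P3.
  assert (H6 : Rpower X (1 - s) * Rpower X s <=
    Rpower (/ g) (1 - s) * (c ^ m * / 3 ^ m) * (Rpower K0 s * (3 ^ m * Rpower d s))).
  { apply Rmult_le_compat; lra. }
  replace (2 / (c * r0) * Rpower (/ g) (1 - s) * Rpower K0 s * Rpower d s) with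
    (2 / (c * r0) * / c ^ m * (Rpower (/ g) (1 - s) * (c ^ m * / 3 ^ m) * (Rpower K0 s * (3 ^ m * Rpower d s))))
    by (field; repeat split; lra).
  apply Rmult_le_compat_l; trivial.
  apply Rmult_le_pos; [lra|]. left; now apply Rinv_0_lt_compat.
Qed.

(** The parameters coded by points of U_i form a set of diameter at most Cs r_i^s. With sum below 1
    / (16 Cs) these sets miss some t, and then the cover misses the point coded by t. *)
Lemma Hmeas_coded_neq_0 (s : R) : 0 < s < 1 -> Hmeas s (Iab lam a b) <> Finite 0.
Proof.
  intros Hs H0. destruct (coding_inverse_holder s Hs) as (Cs & HCs & Hhol).
  set (e := / (16 * Cs)). assert (He : 0 < e) by (apply Rinv_0_lt_compat; lra).
  assert (Hd : Rbar_le (Hdelta s (/ (INR 0 + 1)) (Iab lam a b)) (Finite 0)).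
  { rewrite <- H0. unfold Hmeas.
    apply (Sup_seq_ge (fun n => Hdelta s (/ (INR n + 1)) (Iab lam a b)) 0). }
  assert (Hcov : exists x U r, delta_cover (/ (INR 0 + 1)) (Iab lam a b) U r /\
    cover_sum s r = Finite x /\ x < e).
  { apply NNPP. intros Hno.
    assert (Hle : Rbar_le (Finite e) (Hdelta s (/ (INR 0 + 1)) (Iab lam a b))).
    { apply (proj2 (Glb_Rbar_correct _)). intros x (U & r & Hc & Hx).
      simpl. apply Rnot_lt_le. intros Hxe. apply Hno. exists x, U, r. tauto. }
    generalize (Rbar_le_trans _ _ _ Hle Hd). simpl. lra. }
  destruct Hcov as (x & U & r & (Hr & HU & HA) & Hx & Hxe).
  destruct (small_sets_no_cover
    (fun i t => 0 <= t < 1 /\ exists z, coded_by t z /\ U i z)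
    (fun i => Cs * rpow (r i) s)) as (t & Ht & Hno).
  - intros i. apply Rmult_le_pos; [lra|apply rpow_ge_0].
  - intros i t t' (Ht & z & Hz & HUz) (Ht' & w & Hw & HUw).
    destruct (Req_dec t t') as [->|Hn].
    { rewrite Rminus_diag, Rabs_R0. apply Rmult_le_pos; [lra|apply rpow_ge_0]. }
    destruct (Hhol t t' z w Ht Ht' Hn Hz Hw) as [Hpos Hle].
    apply Rle_trans with (1 := Hle). apply Rmult_le_compat_l; [lra|].
    specialize (HU i z w HUz HUw). rewrite rpow_pos_eq by lra.
    apply Rle_Rpower_l; [lra|split; trivial].
  - intros m.
    assert (Hm : sum_n (fun i => rpow (r i) s) m <= x).
    { change (Rbar_le (Finite (sum_n (fun i => rpow (r i) s) m)) (Finite x)). rewrite <- Hx.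
      apply (Sup_seq_ge (fun n => Finite (sum_n (fun i => rpow (r i) s) n)) m). }
    assert (Heq : sum_n (fun i => Cs * rpow (r i) s) m = Cs * sum_n (fun i => rpow (r i) s) m).
    { exact (sum_n_mult_l (K := R_Ring) Cs (fun i => rpow (r i) s) m). }
    rewrite Heq. apply Rle_trans with (Cs * e); [apply Rmult_le_compat_l; lra|].
    right. unfold e. field. lra.
  - destruct (coded_exists t Ht) as (z & Hz).
    destruct (HA z (coded_in_Iab t z Ht Hz)) as (i & Hi).
    apply (Hno i). split; trivial. now exists z.
Qed.

End LowerBound.

(** * Limit hypotheses as explicit bounds, and the conclusion *)

Lemma LimInf_gt_eventually (u : nat -> R) (l : R) :
  Rbar_lt (Finite l) (LimInf_seq u) -> exists N, forall n, (N <= n)%nat -> l <= u n.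
Proof.
  unfold LimInf_seq. destruct (ex_LimInf_seq u) as [[L| |] H]; simpl; intros Hl; [| |tauto].
  - assert (He : 0 < L - l) by lra.
    destruct (proj2 (H (mkposreal _ He))) as (N & HN). exists N. intros n Hn.
    specialize (HN n Hn). simpl in HN. lra.
  - destruct (H l) as (N & HN). exists N. intros n Hn. specialize (HN n Hn). lra.
Qed.

(** Bounds at infinitely many times suffice for the upper estimate, since each cover there starts
    from a single final level. *)
Lemma LimInf_lt_infty_frequently (u : nat -> R) :
  Rbar_lt (LimInf_seq u) p_infty ->
  exists B, forall N, exists n, (N <= n)%nat /\ u n <= B.
Proof.
  unfold LimInf_seq. destruct (ex_LimInf_seq u) as [[L| |] H]; simpl; intros Hl; [|tauto|].
  - exists (L + 1). intros N. destruct (proj1 (H (mkposreal 1 Rlt_0_1)) N) as (n & Hn & Hun).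
    exists n. split; trivial. simpl in Hun. lra.
  - exists 0. intros N. destruct (H 0 N) as (n & Hn & Hun). exists n. split; trivial. lra.
Qed.

Lemma LimSup_lt_infty_eventually (u : nat -> R) :
  Rbar_lt (LimSup_seq u) p_infty ->
  exists B N, forall n, (N <= n)%nat -> u n <= B.
Proof.
  unfold LimSup_seq. destruct (ex_LimSup_seq u) as [[L| |] H]; simpl; intros Hl; [|tauto|].
  - destruct (proj2 (H (mkposreal 1 Rlt_0_1))) as (N & HN). exists (L + 1), N.
    intros n Hn. specialize (HN n Hn). simpl in HN. lra.
  - destruct (H 0) as (N & HN). exists 0, N. intros n Hn. specialize (HN n Hn). lra.
Qed.

Lemma prod1_superexponential (a : nat -> R) :
  (forall n, (1 <= n)%nat -> 0 < a n) ->
  is_lim_seq (fun n => rpow (prod1 a n) (/ INR n)) p_infty ->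
  forall K, 0 < K -> exists N, forall n, (N <= n)%nat -> K ^ n <= prod1 a n.
Proof.
  intros Ha Hlim K HK. apply is_lim_seq_spec in Hlim.
  destruct (Hlim K) as (N & HN). exists (S N). intros n Hn.
  specialize (HN n ltac:(lia)). generalize (prod1_pos a n Ha); intros Hp.
  rewrite rpow_pos_eq in HN by trivial.
  assert (Hn0 : 0 < INR n) by (apply lt_0_INR; lia).
  rewrite <- Rpower_pow by trivial.
  replace (prod1 a n) with (Rpower (Rpower (prod1 a n) (/ INR n)) (INR n)).
  - apply Rle_Rpower_l; [lra|split; [trivial|lra]].
  - rewrite Rpower_mult, Rinv_l by lra. now apply Rpower_1.
Qed.

Lemma logp_root_le (x B : R) (n : nat) : (1 <= n)%nat -> 0 < x -> 1 <= B ->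
  rpow (logp x) (/ INR n) <= B -> x <= exp (B ^ n).
Proof.
  intros Hn Hx HB H. assert (HBn : 1 <= B ^ n) by now apply pow_R1_Rle.
  assert (Hn0 : 0 < INR n) by (apply lt_0_INR; lia).
  rewrite <- (exp_ln x) by trivial. apply exp_le.
  apply Rle_trans with (logp x); [apply Rmax_l|].
  destruct (Rle_lt_dec (logp x) 0) as [h|h]; [lra|].
  rewrite rpow_pos_eq in H by trivial. rewrite <- Rpower_pow by lra.
  replace (logp x) with (Rpower (Rpower (logp x) (/ INR n)) (INR n)).
  - apply Rle_Rpower_l; [lra|split; [apply Rpower_pos|trivial]].
  - rewrite Rpower_mult, Rinv_l by lra. now apply Rpower_1.
Qed.

Lemma Mslow_bound (lam : nat -> C) (z : C) : Mslow lam z ->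
  exists N B, forall n, (N <= n)%nat -> Cmod (Eiter lam n z) <= exp (B ^ n).
Proof.
  intros [Hesc Hsup]. apply is_lim_seq_spec in Hesc.
  destruct (LimSup_lt_infty_eventually _ Hsup) as (B & N1 & H1).
  (* Once the modulus exceeds 1 its logarithm is positive, so the double logarithm is genuine and
     not a default value of [ln]. The base found is e^B. *)
  destruct (Hesc 1) as (N2 & H2).
  exists (S (max N1 N2)), (exp B). intros n Hn.
  specialize (H1 n ltac:(lia)). specialize (H2 n ltac:(lia)). simpl in H2.
  assert (Hn0 : 0 < INR n) by (apply lt_0_INR; lia).
  assert (Hln : 0 < ln (Cmod (Eiter lam n z))) by (rewrite <- ln_1; apply ln_increasing; lra).
  rewrite <- (exp_ln (Cmod (Eiter lam n z))) by lra. apply exp_le.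
  rewrite <- (exp_ln (ln _)) by trivial. rewrite <- Rpower_pow by apply exp_pos.
  unfold Rpower. rewrite ln_exp. apply exp_le.
  apply (Rmult_le_compat_r (INR n)) in H1; [|lra].
  replace (ln (ln (Cmod (Eiter lam n z))) / INR n * INR n)
    with (ln (ln (Cmod (Eiter lam n z)))) in H1 by (field; lra). lra.
Qed.

Lemma dimH_eq_1 (A : C -> Prop) :
  (forall s, 1 < s -> Hmeas s A = Finite 0) ->
  (forall s, 0 < s < 1 -> Hmeas s A <> Finite 0) -> dimH A = Finite 1.
Proof.
  intros Hup Hlow. apply is_glb_Rbar_unique. split.
  - intros s [Hs H]. simpl. apply Rnot_lt_le. intros Hs1. now apply (Hlow s).
  - intros l Hl.
    assert (H : forall eps : posreal, Rbar_le l (Finite (1 + eps))).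
    { intros eps. apply Hl. generalize (cond_pos eps); intros. split; [lra|apply Hup; lra]. }
    destruct l as [l| |]; simpl in *; trivial.
    + apply le_epsilon. intros e He. apply (H (mkposreal e He)).
    + apply (H (mkposreal 1 Rlt_0_1)).
Qed.

Lemma Iab_Hmeas_neq_0 (q D : R) (lam : nat -> C) (a b : nat -> R) (n0 : nat) (s : R) :
  (forall n, (1 <= n)%nat -> lam n <> 0%C) ->
  (forall n, (1 <= n)%nat -> 0 < a n) ->
  0 < q < 1 -> 0 < D <= 1 -> (1 <= n0)%nat ->
  (forall n, (n0 <= n)%nat ->
     a (S n) <= Cmod (lam (S n)) * exp (q * a n) /\
     Cmod (lam (S n)) * exp (- (q * a n)) <= b (S n)) ->
  (forall n, (n0 <= n)%nat -> a n * exp D <= b n) ->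
  (forall n, (n0 <= n)%nat -> 512 <= D * a n /\ 3 * D <= 2 * (1 - q) * a n) ->
  (forall K, 0 < K -> exists N, forall n, (N <= n)%nat -> K ^ n <= prod1 a n) ->
  0 < s < 1 -> Hmeas s (Iab lam a b) <> Finite 0.
Proof.
  intros Hlam Ha Hq HD Hn0 Hstep Hab Hbig Hgrow Hs.
  assert (Hp : forall m, exists p : R * nat,
    (2 <= snd p)%nat /\
    D / 256 * inner_radius lam a q D n0 m <= INR (snd p) <= inner_radius lam a q D n0 m /\
    0 < fst p /\
    Cmult (lam (S (n0 + m))) (cos (fst p), sin (fst p)) = RtoC (Cmod (lam (S (n0 + m)))) /\
    forall (k : nat) (x y : R), (k < snd p)%nat ->
      strip_left lam a q D n0 m <= x <= strip_left lam a q D n0 m + D ->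
      fst p + 4 * PI * INR k <= y <= fst p + 4 * PI * INR k + PI ->
      inner_radius lam a q D n0 m ^ 2 <= x ^ 2 + y ^ 2 <= (inner_radius lam a q D n0 m * exp D) ^ 2).
  { intros m.
    assert (Hr : 512 <= D * inner_radius lam a q D n0 m /\
                 3 * D <= 2 * (1 - q) * inner_radius lam a q D n0 m) by now apply inner_radius_big.
    apply level_boxes with q; trivial; try apply Hr.
    - now apply strip_left_bound with b.
    - apply Hlam; lia. }
  apply functional_choice in Hp. destruct Hp as (p & Hp).
  destruct (Eiter_pullback lam n0 (inner_radius lam a q D n0 0) (inner_radius lam a q D n0 0 * exp D))
    as (M & HM); [trivial|simpl; now apply Ha|].
  apply (Hmeas_coded_neq_0 lam a b q D n0) with (beta := fun m => fst (p m)) (N := fun m => snd (p m)) (M := M);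
    trivial; intros m; apply (Hp m).
Qed.

Theorem theorem2p12 :
  forall (q Delta : R), 0 < q < 1 -> 0 < Delta ->
  exists a0 : R, 0 < a0 /\
  forall (lam : nat -> C) (a b : nat -> R),
    (forall n, (1 <= n)%nat -> lam n <> 0%C) ->
    (forall n, (1 <= n)%nat -> 0 < a n < b n) ->
    (* (a) *)
    (exists N : nat, forall n, (N <= n)%nat -> (1 <= n)%nat ->
        a (S n) <= Cmod (lam (S n)) * exp (q * a n) /\
        Cmod (lam (S n)) * exp (- (q * a n)) <= b (S n)) ->
    (* (b) *)
    is_lim_seq (fun n => rpow (prod1 a n) (/ INR n)) p_infty ->
    (* (c) *)
    (forall n, (1 <= n)%nat -> Delta < ln (b n / a n)) ->
    (* (d) *)
    Rbar_lt (Finite a0) (LimInf_seq a) ->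
    ( Rbar_lt (LimInf_seq (fun n => rpow (logp (b n)) (/ INR n))) p_infty ->
      dimH (Iab lam a b) = Finite 1 )
    /\
    ( (forall z, Iab lam a b z -> Mslow lam z) ->
      dimH (Iab lam a b) = Finite 1 ).
Proof.
  intros q Delta Hq HDelta.
  (* Truncation preserves the lower bound on the widths and provides D <= 1, as [level_boxes] and
     e^D <= 3 require. *)
  set (D := Rmin Delta 1).
  assert (HD : 0 < D <= 1) by (split; [apply Rmin_pos; lra|apply Rmin_r]).
  assert (H512 : 0 < 512 / D) by (apply Rdiv_lt_0_compat; lra).
  set (a0 := Rmax (512 / D) (3 * D / (2 * (1 - q)))).
  assert (Ha01 : 512 / D <= a0) by apply Rmax_l.
  assert (Ha02 : 3 * D / (2 * (1 - q)) <= a0) by apply Rmax_r.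
  exists a0. split; [lra|].
  intros lam a b Hlam Hab (N1 & Hstep) Hb Hc Hd.
  assert (Ha : forall n, (1 <= n)%nat -> 0 < a n) by (intros n Hn; now apply Hab).
  generalize (prod1_superexponential a Ha Hb); intros Hgrow.
  destruct (LimInf_gt_eventually a a0 Hd) as (N2 & HN2).
  assert (Hbig : forall n, (N2 <= n)%nat -> 512 <= D * a n /\ 3 * D <= 2 * (1 - q) * a n).
  { intros n Hn. specialize (HN2 n Hn). split.
    - replace 512 with (D * (512 / D)) by (field; lra). apply Rmult_le_compat_l; lra.
    - replace (3 * D) with (2 * (1 - q) * (3 * D / (2 * (1 - q)))) by (field; lra).
      apply Rmult_le_compat_l; lra. }
  assert (Ha2 : exists N, forall n, (N <= n)%nat -> 2 <= a n).
  { exists (S N2). intros n Hn. destruct (Hbig n) as [H _]; [lia|]. specialize (Ha n ltac:(lia)). nra. }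
  assert (Hlow : forall s, 0 < s < 1 -> Hmeas s (Iab lam a b) <> Finite 0).
  { intros s Hs. apply (Iab_Hmeas_neq_0 q D lam a b (S (max N1 N2))); trivial; try lia.
    - intros n Hn. apply Hstep; lia.
    - intros n Hn. specialize (Hc n ltac:(lia)). specialize (Hab n ltac:(lia)).
      assert (Hba : 0 < b n / a n) by (apply Rdiv_lt_0_compat; lra).
      replace (b n) with (a n * exp (ln (b n / a n))) by (rewrite exp_ln by trivial; field; lra).
      apply Rmult_le_compat_l; [lra|]. apply exp_le.
      apply Rle_trans with Delta; [apply Rmin_l|lra].
    - intros n Hn. apply Hbig; lia. }
  split.
  - intros Hlim. destruct (LimInf_lt_infty_frequently _ Hlim) as (B & HB).
    apply dimH_eq_1; trivial. intros s Hs.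
    (* The good times depend on [b] alone, so they are common to all points of the set. *)
    apply (Hmeas_upper lam a (fun n => (1 <= n)%nat /\ rpow (logp (b n)) (/ INR n) <= B)); trivial.
    + intros N. destruct (HB (S N)) as (n & Hn & Hn'). exists n. repeat split; trivial; lia.
    + intros z (N & HN). exists N, (Rmax B 1). intros n Hn. destruct (HN n Hn) as [H1 H2].
      split; trivial. intros [Hn1 HnB]. apply Rle_trans with (1 := H2).
      specialize (Hab n Hn1). apply logp_root_le; trivial; [lra|apply Rmax_r|].
      apply Rle_trans with (1 := HnB), Rmax_l.
  - intros HM. apply dimH_eq_1; trivial. intros s Hs.
    (* Slow escape bounds the orbit at all late times, with a base that depends on the point; the
       countable decomposition takes care of that dependence. *)
    apply (Hmeas_upper lam a (fun _ => True)); trivial.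
    + intros N. exists N. split; trivial.
    + intros z Hz. destruct (Mslow_bound lam z (HM z Hz)) as (N3 & B & H3).
      destruct Hz as (N & HN). exists (max N N3), B. intros n Hn. split.
      * apply HN; lia.
      * intros _. apply H3; lia.
Qed.
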